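(* Let $\lambda>0$, $a>0$, $\Gamma\ge0$ be real numbers with $\lambda\ge6\max\{\Gamma,1/a\}$, and let $v\in L^1(\mathbb{R})$ satisfy $|v(\xi)|\le\Gamma e^{-a|\xi|}$ for all $\xi\in\mathbb{R}$. Then there exists $\psi\in L^1(\mathbb{R})$ with $\psi=R[\psi]$ (the $L^1$-limit of the iterates $\psi_0=v$, $\psi_{n+1}=R[\psi_n]$) such that $$|\psi(\xi)|\le2\Gamma\exp\!\left(-\left(a-\frac1\lambda\right)|\xi|\right)\quad\text{for all }\xi\in\mathbb{R}.$$
   Context: Fix an infinitely differentiable $b:\mathbb{R}\to[0,1]$ with $b(\xi)=1$ for $|\xi|\le\lambda$ and $b(\xi)=0$ for $|\xi|\ge\sqrt2\lambda$. Convolution is normalized: $f*g(\xi)=\frac1{2\pi}\int f(\eta)g(\xi-\eta)\,d\eta$; $f^{*m}$ is the $m$-fold convolution. For $f\in L^1$: $W_b[f](\xi)=f(\xi)\frac{b(\xi)}{4\lambda^2-\xi^2}$, $\widetilde W_b[f](\xi)=f(\xi)\frac{i\xi\,b(\xi)}{4\lambda^2-\xi^2}$, $\exp_2^*[f]=\sum_{m\ge2}\frac{f^{*m}}{m!}$, and $R[f]=\frac14\widetilde W_b[f]*\widetilde W_b[f]-4\lambda^2\exp_2^*[W_b[f]]+v$. *)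

(* Defs.v *)
From Stdlib Require Import Reals Lra List Arith Factorial ClassicalEpsilon.
Open Scope R_scope.

Definition Cplx := (R * R)%type.
Definition Re (z : Cplx) : R := fst z.
Definition Im (z : Cplx) : R := snd z.
Definition Cadd (z w : Cplx) : Cplx := (Re z + Re w, Im z + Im w).
Definition Csub (z w : Cplx) : Cplx := (Re z - Re w, Im z - Im w).
Definition Cmul (z w : Cplx) : Cplx :=
  (Re z * Re w - Im z * Im w, Re z * Im w + Im z * Re w).
Definition Cscal (r : R) (z : Cplx) : Cplx := (r * Re z, r * Im z).
Definition Cnorm (z : Cplx) : R := sqrt (Re z ^ 2 + Im z ^ 2).
Definition Ci : Cplx := (0, 1).

Fixpoint tagged_div (a b : R) (l : list (R * R * R)) : Prop :=
  match l with
  | nil => a = b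
  | ((x, t), y) :: l' => x = a /\ x <= t <= y /\ tagged_div y b l'
  end.

Definition fine (delta : R -> R) (l : list (R * R * R)) : Prop :=
  Forall (fun p => match p with ((x, t), y) =>
            t - delta t < x /\ y < t + delta t end) l.

Definition rsum (f : R -> R) (l : list (R * R * R)) : R :=
  fold_right (fun p acc => match p with ((x, t), y) =>
                f t * (y - x) + acc end) 0 l.

Definition HK_has_integral (a b : R) (f : R -> R) (I : R) : Prop :=
  forall eps, 0 < eps ->
  exists delta : R -> R, (forall t, 0 < delta t) /\
    forall l, tagged_div a b l -> fine delta l -> Rabs (rsum f l - I) < eps.

Definition HK_integrable (a b : R) (f : R -> R) : Prop :=
  exists I, HK_has_integral a b f I.

Definition HK_int (a b : R) (f : R -> R) : R :=
  epsilon (inhabits 0) (fun I => HK_has_integral a b f I).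

Definition L1 (f : R -> Cplx) : Prop :=
  (forall a b, a <= b ->
     HK_integrable a b (fun x => Re (f x)) /\
     HK_integrable a b (fun x => Im (f x)) /\
     HK_integrable a b (fun x => Cnorm (f x))) /\
  (exists M, forall a b, a <= b -> HK_int a b (fun x => Cnorm (f x)) <= M).

(* integral over R of a real function (meaningful for integrable ones) *)
Definition Rint (g : R -> R) : R :=
  epsilon (inhabits 0)
    (fun I => Un_cv (fun n => HK_int (- INR n) (INR n) g) I).

Definition Cint (h : R -> Cplx) : Cplx :=
  (Rint (fun x => Re (h x)), Rint (fun x => Im (h x))).

Definition L1norm (f : R -> Cplx) : R := Rint (fun x => Cnorm (f x)).

Definition conv (f g : R -> Cplx) (xi : R) : Cplx :=
  Cscal (/ (2 * PI)) (Cint (fun eta => Cmul (f eta) (g (xi - eta)))).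

(* convpow f n = f^{*(n+1)} *)
Fixpoint convpow (f : R -> Cplx) (n : nat) : R -> Cplx :=
  match n with
  | O => f
  | S k => conv (convpow f k) f
  end.

(* exp_2^*[f] = sum_{m >= 2} f^{*m} / m!  (pointwise sum of the series) *)
Definition exp2star (f : R -> Cplx) (xi : R) : Cplx :=
  (epsilon (inhabits 0) (fun s =>
     infinite_sum (fun k => Re (convpow f (S k) xi) / INR (fact (k + 2))) s),
   epsilon (inhabits 0) (fun s =>
     infinite_sum (fun k => Im (convpow f (S k) xi) / INR (fact (k + 2))) s)).

Definition Wb (lam : R) (b : R -> R) (f : R -> Cplx) (xi : R) : Cplx :=
  Cscal (b xi / (4 * lam ^ 2 - xi ^ 2)) (f xi).

Definition Wtb (lam : R) (b : R -> R) (f : R -> Cplx) (xi : R) : Cplx :=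
  Cmul (Cscal (xi * b xi / (4 * lam ^ 2 - xi ^ 2)) Ci) (f xi).

Definition Rop (lam : R) (b : R -> R) (v : R -> Cplx) (f : R -> Cplx) (xi : R) : Cplx :=
  Cadd (Csub (Cscal (1 / 4) (conv (Wtb lam b f) (Wtb lam b f) xi))
             (Cscal (4 * lam ^ 2) (exp2star (Wb lam b f) xi)))
       (v xi).

Definition smooth (b : R -> R) : Prop :=
  exists D : nat -> R -> R, D O = b /\
    forall n x, derivable_pt_lim (D n) x (D (S n) x).

Definition cutoff (lam : R) (b : R -> R) : Prop :=
  smooth b /\ (forall xi, 0 <= b xi <= 1) /\
  (forall xi, Rabs xi <= lam -> b xi = 1) /\
  (forall xi, sqrt 2 * lam <= Rabs xi -> b xi = 0).

Fixpoint iterR (lam : R) (b : R -> R) (v : R -> Cplx) (n : nat) : R -> Cplx :=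
  match n with
  | O => v
  | S k => Rop lam b v (iterR lam b v k)
  end.

(* Main.v *)
(** Measure the iterates in the weighted sup norm [sup |f(x)| exp (a |x|)].
    Since [exp (- a |y|) exp (- a |x - y|) <= exp (- a |x|)] and all factors of
    the convolutions are supported in [|x| <= sqrt 2 lam], this norm controls
    convolution with a constant of order [lam]; with [6 Gamma <= lam] the
    operator [R] maps the ball of radius [2 Gamma] to itself and contracts it.
    Hence the iterates converge and even [|psi| <= 2 Gamma exp (- a |x|)].

    The analytic input is that a bounded Henstock-Kurzweil integrable function
    is locally [L1]-approximable by continuous functions.  This gives the
    integrability of products, and convolutions are again approximable, so no
    theorem of Fubini type is needed. *)
From Coquelicot Require Import Coquelicot.
From Stdlib Require Import Reals Factorial Lra Lia List ClassicalEpsilon Psatz FunctionalExtensionality.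
Require Import Defs.
Open Scope R_scope.

(** Integrability of a product does not follow formally from gauge integrability of the factors:
    measurability is the missing information, and local approximability by continuous functions
    takes its place. Moreover, integrals and series values are picked by [epsilon] and mean nothing
    until existence is proved, so even linearity of an integral needs existence first. This is why
    [approximableC] accompanies every norm bound. Constants: write S for [sqrt 2 * lam]. Convolution
    with a function supported in [|x| <= S] costs [2 / 3 * S], and [Wb] costs [/ (2 * lam ^ 2)], so
    on the ball of radius [2 * Gamma] each further convolution factor costs at most q = [2 / 3 * S *
    (/ (2 * lam ^ 2) * (2 * Gamma))], which is at most [1 / 6]. The quadratic and exponential terms
    together contribute [(9 / 16 + 24 / 5) * q < 9 / 10], times [Gamma] in the ball estimate and
    times the distance in the contraction estimate. The full rate [a] survives because the
    integration window has bounded length: no part of the decay is spent on making the integral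
    converge. *)

(** * The gauge integral on an interval *)

Definition gauge (d : R -> R) := forall t, 0 < d t.

Lemma gauge_min (d1 d2 : R -> R) :
  gauge d1 -> gauge d2 -> gauge (fun t => Rmin (d1 t) (d2 t)).
Proof. intros H1 H2 t; now apply Rmin_glb_lt. Qed.

Lemma fine_min_l (d1 d2 : R -> R) l :
  fine (fun t => Rmin (d1 t) (d2 t)) l -> fine d1 l.
Proof.
apply Forall_impl; intros [[x t] y] [H1 H2].
pose proof (Rmin_l (d1 t) (d2 t)); lra.
Qed.

Lemma fine_min_r (d1 d2 : R -> R) l :
  fine (fun t => Rmin (d1 t) (d2 t)) l -> fine d2 l.
Proof.
apply Forall_impl; intros [[x t] y] [H1 H2].
pose proof (Rmin_r (d1 t) (d2 t)); lra.
Qed.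

Lemma fine_app (d : R -> R) l1 l2 : fine d l1 -> fine d l2 -> fine d (l1 ++ l2).
Proof. intros H1 H2; apply Forall_app; now split. Qed.

Lemma tagged_div_le a b l : tagged_div a b l -> a <= b.
Proof.
revert a; induction l as [|[[x t] y] l IH]; simpl; intros a.
- lra.
- intros [-> [H1 H2]]; apply IH in H2; lra.
Qed.

Lemma tagged_div_app a b c l1 l2 :
  tagged_div a b l1 -> tagged_div b c l2 -> tagged_div a c (l1 ++ l2).
Proof.
revert a; induction l1 as [|[[x t] y] l IH]; simpl; intros a.
- now intros ->.
- intros [-> [H1 H2]] H3; repeat split; try apply H1; now apply IH.
Qed.

(** Supremum argument over the points reachable from [a] by fine divisions. *)
Lemma cousin (d : R -> R) a b :
  gauge d -> a <= b -> exists l, tagged_div a b l /\ fine d l.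
Proof.
intros Hd Hab.
set (E := fun x => a <= x <= b /\ exists l, tagged_div a x l /\ fine d l).
assert (Ea : E a) by (split; [lra|]; exists nil; split; [reflexivity|constructor]).
destruct (completeness E) as [c [Hub Hlub]].
- exists b; intros x [Hx _]; lra.
- now exists a.
- assert (Hc : a <= c <= b).
  { split; [now apply Hub|]. apply Hlub; intros x [Hx _]; lra. }
  pose proof (Hd c) as Hdc.
  assert (Hx : exists x, E x /\ c - d c < x).
  { apply Classical_Prop.NNPP; intros Hn.
    assert (c <= c - d c); [|lra].
    apply Hlub; intros x Ex. apply Rnot_lt_le; intros Hlt; apply Hn; now exists x. }
  destruct Hx as [x [[Hx [l [Hl Hf]]] Hxc]].
  assert (Hxc' : x <= c) by (apply Hub; split; [lra|now exists l]).
  (* One cell tagged [c] starts at a reachable point close to [c] and ends beyond [c] unless [b]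
     stops it, so the supremum is reachable and cannot lie below [b]. *)
  set (y := Rmin b (c + d c / 2)).
  assert (Hy : c <= y) by (apply Rmin_glb; lra).
  assert (Hyb : y <= b) by apply Rmin_l.
  assert (Hyc : y <= c + d c / 2) by apply Rmin_r.
  assert (Ey : E y).
  { split; [lra|]. exists (l ++ (((x, c), y) :: nil)); split.
    - apply tagged_div_app with x; [exact Hl|simpl; repeat split; lra].
    - apply fine_app; [exact Hf|]. constructor; [lra|constructor]. }
  assert (y = b).
  { destruct (Rle_lt_dec b (c + d c / 2)) as [H|H].
    - unfold y; now apply Rmin_left.
    - assert (y = c + d c / 2) by (unfold y; apply Rmin_right; lra).
      pose proof (Hub y Ey); lra. }
  subst y; rewrite H in Ey; apply Ey.
Qed.

Lemma rsum_app f l1 l2 : rsum f (l1 ++ l2) = rsum f l1 + rsum f l2.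
Proof.
induction l1 as [|[[x t] y] l IH]; simpl; [ring|].
rewrite IH; ring.
Qed.

Lemma rsum_lin c d f g l :
  rsum (fun x => c * f x + d * g x) l = c * rsum f l + d * rsum g l.
Proof.
induction l as [|[[x t] y] l IH]; simpl; [ring|].
rewrite IH; ring.
Qed.

Lemma hk_unique a b f I J : a <= b ->
  HK_has_integral a b f I -> HK_has_integral a b f J -> I = J.
Proof.
intros Hab HI HJ; apply cond_eq; intros eps Heps.
destruct (HI (eps / 2)) as [d1 [Hd1 H1]]; [lra|].
destruct (HJ (eps / 2)) as [d2 [Hd2 H2]]; [lra|].
destruct (cousin _ a b (gauge_min d1 d2 Hd1 Hd2) Hab) as [l [Hl Hf]].
specialize (H1 l Hl (fine_min_l _ _ _ Hf)).
specialize (H2 l Hl (fine_min_r _ _ _ Hf)).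
apply Rabs_def2 in H1; apply Rabs_def2 in H2; apply Rabs_def1; lra.
Qed.

Lemma hk_int_has a b f : HK_integrable a b f -> HK_has_integral a b f (HK_int a b f).
Proof. intros H; exact (epsilon_spec (inhabits 0) _ H). Qed.

Lemma hk_int_eq a b f I : a <= b -> HK_has_integral a b f I -> HK_int a b f = I.
Proof.
intros Hab H; apply (hk_unique a b f); try assumption.
apply hk_int_has; now exists I.
Qed.

Lemma hk_lin a b c d f g I J :
  HK_has_integral a b f I -> HK_has_integral a b g J ->
  HK_has_integral a b (fun x => c * f x + d * g x) (c * I + d * J).
Proof.
intros HI HJ eps Heps.
set (k := Rabs c + Rabs d + 1).
assert (Hk : 0 < k) by (pose proof (Rabs_pos c); pose proof (Rabs_pos d); unfold k; lra).
assert (Hek : 0 < eps / k) by (now apply Rdiv_lt_0_compat).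
destruct (HI _ Hek) as [d1 [Hd1 H1]].
destruct (HJ _ Hek) as [d2 [Hd2 H2]].
exists (fun t => Rmin (d1 t) (d2 t)); split; [now apply gauge_min|].
intros l Hl Hf.
specialize (H1 l Hl (fine_min_l _ _ _ Hf)).
specialize (H2 l Hl (fine_min_r _ _ _ Hf)).
rewrite rsum_lin.
replace (c * rsum f l + d * rsum g l - (c * I + d * J))
  with (c * (rsum f l - I) + d * (rsum g l - J)) by ring.
eapply Rle_lt_trans; [apply Rabs_triang|]. rewrite !Rabs_mult.
apply Rle_lt_trans with (Rabs c * (eps / k) + Rabs d * (eps / k)).
- apply Rplus_le_compat; apply Rmult_le_compat_l; try apply Rabs_pos; lra.
- replace eps with (k * (eps / k)) at 3 by (field; lra). unfold k at 3; nra.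
Qed.

Lemma hk_ext a b f g I :
  (forall x, a <= x <= b -> f x = g x) -> HK_has_integral a b f I -> HK_has_integral a b g I.
Proof.
intros Hfg HI eps Heps; destruct (HI eps Heps) as [d [Hd H]].
exists d; split; [exact Hd|]. intros l Hl Hf.
replace (rsum g l) with (rsum f l); [now apply H|].
clear H Hf.
cut (forall x0, a <= x0 -> tagged_div x0 b l -> rsum f l = rsum g l).
{ intros Hx; apply (Hx a); [lra|exact Hl]. }
clear Hl; induction l as [|[[x t] y] l IH]; simpl; intros x0 Ha; [reflexivity|].
intros [-> [Ht Hl]]. pose proof (tagged_div_le _ _ _ Hl).
rewrite (IH y); [|lra|exact Hl]. rewrite Hfg; [reflexivity|lra].
Qed.

(** The integral over the union is assumed to exist, so one fine division of each half,
    concatenated, compares the three values. Deducing its existence would need a gauge that forces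
    [b] to be a tag. *)
Lemma hk_chasles a b c f I J K : a <= b -> b <= c ->
  HK_has_integral a b f I -> HK_has_integral b c f J -> HK_has_integral a c f K ->
  K = I + J.
Proof.
intros Hab Hbc HI HJ HK; apply cond_eq; intros eps Heps.
destruct (HI (eps / 3)) as [d1 [Hd1 H1]]; [lra|].
destruct (HJ (eps / 3)) as [d2 [Hd2 H2]]; [lra|].
destruct (HK (eps / 3)) as [d3 [Hd3 H3]]; [lra|].
pose proof (gauge_min _ _ (gauge_min _ _ Hd1 Hd2) Hd3) as Hd.
destruct (cousin _ a b Hd Hab) as [l1 [Hl1 Hf1]].
destruct (cousin _ b c Hd Hbc) as [l2 [Hl2 Hf2]].
specialize (H1 _ Hl1 (fine_min_l _ _ _ (fine_min_l _ _ _ Hf1))).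
specialize (H2 _ Hl2 (fine_min_r _ _ _ (fine_min_l _ _ _ Hf2))).
specialize (H3 _ (tagged_div_app _ _ _ _ _ Hl1 Hl2)
  (fine_app _ _ _ (fine_min_r _ _ _ Hf1) (fine_min_r _ _ _ Hf2))).
rewrite rsum_app in H3.
apply Rabs_def2 in H1; apply Rabs_def2 in H2; apply Rabs_def2 in H3.
apply Rabs_def1; lra.
Qed.

Lemma hk_point a f : HK_has_integral a a f 0.
Proof.
intros eps Heps; exists (fun _ => 1); split; [intros; lra|].
intros l Hl _. replace (rsum f l) with 0; [rewrite Rminus_0_r, Rabs_R0; exact Heps|].
symmetry; revert Hl. induction l as [|[[x t] y] l IH]; simpl; [reflexivity|].
intros [-> [Ht Hl]]. pose proof (tagged_div_le _ _ _ Hl).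
assert (y = a) by lra; subst y. rewrite IH; [ring|exact Hl].
Qed.

(** * Upper integrals by monotone majorants *)

(* The upper integral of [|phi|] over [A, B] is at most [eps].  The increments
   of [Phi] replace sums over tagged divisions, so that restriction, reflection
   and domination become pointwise statements. *)
Definition small (A B : R) (phi : R -> R) (eps : R) : Prop :=
  exists (d Phi : R -> R), gauge d /\
    (forall x y, A <= x -> x <= y -> y <= B -> Phi x <= Phi y) /\
    Phi B - Phi A <= eps /\
    forall x t y, A <= x -> x <= t -> t <= y -> y <= B -> t - d t < x -> y < t + d t ->
      Rabs (phi t) * (y - x) <= Phi y - Phi x.

Lemma small_rsum A B phi eps : small A B phi eps ->
  exists d, gauge d /\ forall l, tagged_div A B l -> fine d l -> Rabs (rsum phi l) <= eps.
Proof.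
intros [d [Phi [Hd [Hm [He H]]]]]; exists d; split; [exact Hd|].
intros l Hl Hf. apply Rle_trans with (Phi B - Phi A); [|exact He]. clear He.
cut (forall x0, A <= x0 -> tagged_div x0 B l -> Rabs (rsum phi l) <= Phi B - Phi x0).
{ intros Hx; apply Hx; [lra|exact Hl]. }
clear Hl; revert Hf; induction l as [|[[x t] y] l IH]; simpl; intros Hf x0 Ha.
- intros ->; rewrite Rabs_R0; lra.
- intros [-> [Ht Hl]]. inversion Hf as [|? ? Hxy Hf']; subst.
  pose proof (tagged_div_le _ _ _ Hl).
  assert (HAy : A <= y) by lra. specialize (IH Hf' y HAy Hl).
  eapply Rle_trans; [apply Rabs_triang|].
  assert (Rabs (phi t * (y - x0)) <= Phi y - Phi x0).
  { rewrite Rabs_mult, (Rabs_right (y - x0)) by lra. apply H; lra. }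
  lra.
Qed.

Lemma small_int A B phi eps I : A <= B ->
  small A B phi eps -> HK_has_integral A B phi I -> Rabs I <= eps.
Proof.
intros HAB Hs HI; apply le_epsilon; intros th Hth.
destruct (small_rsum _ _ _ _ Hs) as [d1 [Hd1 H1]].
destruct (HI th Hth) as [d2 [Hd2 H2]].
destruct (cousin _ A B (gauge_min _ _ Hd1 Hd2) HAB) as [l [Hl Hf]].
specialize (H1 l Hl (fine_min_l _ _ _ Hf)).
specialize (H2 l Hl (fine_min_r _ _ _ Hf)).
replace I with (rsum phi l - (rsum phi l - I)) by ring.
eapply Rle_trans; [apply Rabs_triang|]. rewrite Rabs_Ropp; lra.
Qed.

Lemma small_dom A B f g k eps : 0 <= k ->
  (forall x, A <= x <= B -> Rabs (f x) <= k * Rabs (g x)) ->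
  small A B g eps -> small A B f (k * eps).
Proof.
intros Hk Hfg [d [Phi [Hd [Hm [He H]]]]].
exists d, (fun x => k * Phi x); repeat split; try assumption.
- intros; apply Rmult_le_compat_l; auto.
- nra.
- intros x t y H1 H2 H3 H4 H5 H6. specialize (H x t y H1 H2 H3 H4 H5 H6).
  assert (Rabs (f t) <= k * Rabs (g t)) by (apply Hfg; lra). nra.
Qed.

Lemma small_add A B f g h e1 e2 :
  (forall x, A <= x <= B -> Rabs (h x) <= Rabs (f x) + Rabs (g x)) ->
  small A B f e1 -> small A B g e2 -> small A B h (e1 + e2).
Proof.
intros Hh [d [Phi [Hd [Hm [He H]]]]] [d' [Phi' [Hd' [Hm' [He' H']]]]].
exists (fun t => Rmin (d t) (d' t)), (fun x => Phi x + Phi' x).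
repeat split.
- now apply gauge_min.
- intros; apply Rplus_le_compat; auto.
- lra.
- intros x t y H1 H2 H3 H4 H5 H6.
  pose proof (Rmin_l (d t) (d' t)); pose proof (Rmin_r (d t) (d' t)).
  assert (Rabs (f t) * (y - x) <= Phi y - Phi x) by (apply H; lra).
  assert (Rabs (g t) * (y - x) <= Phi' y - Phi' x) by (apply H'; lra).
  assert (Rabs (h t) <= Rabs (f t) + Rabs (g t)) by (apply Hh; lra). nra.
Qed.

Lemma small_const A B f c : 0 <= c ->
  (forall x, A <= x <= B -> Rabs (f x) <= c) -> small A B f (c * (B - A)).
Proof.
intros Hc Hf; exists (fun _ => 1), (fun x => c * x); repeat split.
- intros t; lra.
- intros; nra.
- lra.
- intros x t y **. assert (Rabs (f t) <= c) by (apply Hf; lra). nra.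
Qed.

Lemma small_weaken A B f e1 e2 : e1 <= e2 -> small A B f e1 -> small A B f e2.
Proof.
intros He [d [Phi [Hd [Hm [H1 H]]]]]; exists d, Phi; repeat split; auto; lra.
Qed.

Lemma small_ext A B f g e : (forall x, A <= x <= B -> f x = g x) ->
  small A B f e -> small A B g e.
Proof.
intros Hfg H. replace e with (1 * e) by ring.
apply small_dom with f; [lra| |exact H]. intros x Hx; rewrite Hfg by exact Hx; lra.
Qed.

Lemma small_reflect A B f e c : small A B f e ->
  small (c - B) (c - A) (fun x => f (c - x)) e.
Proof.
intros [d [Phi [Hd [Hm [H1 H]]]]].
exists (fun t => d (c - t)), (fun x => - Phi (c - x)); repeat split.
- intros t; apply Hd.
- intros; apply Ropp_le_contravar, Hm; lra.
- replace (c - (c - A)) with A by ring. replace (c - (c - B)) with B by ring. lra.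
- intros x t y **. replace (- Phi (c - y) - - Phi (c - x)) with (Phi (c - x) - Phi (c - y)) by ring.
  replace (y - x) with ((c - x) - (c - y)) by ring. apply H; lra.
Qed.

(** * Derivatives and continuous integrands *)

(** Differentiability at [t] controls [G y - G t] and [G t - G x] separately; as [t] lies between
    [x] and [y], the two errors add up to at most [eps * (y - x)]. *)
Lemma straddle G g : (forall x, derivable_pt_lim G x (g x)) ->
  forall eps, 0 < eps -> exists d, gauge d /\
    forall x t y, x <= t -> t <= y -> t - d t < x -> y < t + d t ->
      Rabs (g t * (y - x) - (G y - G x)) <= eps * (y - x).
Proof.
intros HG eps Heps.
assert (Hd : forall t, exists d, 0 < d /\ forall h, Rabs h < d ->
   Rabs (G (t + h) - G t - g t * h) <= eps * Rabs h).
{ intros t; destruct (HG t eps Heps) as [d Hd]; exists d; split; [apply cond_pos|].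
  intros h Hh; destruct (Req_dec h 0) as [->|Hh0].
  - rewrite Rplus_0_r, Rabs_R0. replace (G t - G t - g t * 0) with 0 by ring. rewrite Rabs_R0; lra.
  - specialize (Hd h Hh0 Hh).
    replace (G (t + h) - G t - g t * h) with (((G (t + h) - G t) / h - g t) * h) by (field; exact Hh0).
    rewrite Rabs_mult; apply Rmult_le_compat_r; [apply Rabs_pos|lra]. }
exists (fun t => proj1_sig (constructive_indefinite_description _ (Hd t))); split.
- intros t; destruct constructive_indefinite_description as [d Hdt]; simpl; apply Hdt.
- intros x t y Hx Hy; destruct constructive_indefinite_description as [d [Hd0 Hdt]]; simpl.
  intros H1 H2.
  assert (Ha := Hdt (y - t)); assert (Hb := Hdt (x - t)).
  rewrite Rabs_right in Ha by lra. rewrite (Rabs_left1 (x - t)) in Hb by lra.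
  replace (t + (y - t)) with y in Ha by ring. replace (t + (x - t)) with x in Hb by ring.
  assert (Ha' : Rabs (G y - G t - g t * (y - t)) <= eps * (y - t)) by (apply Ha; lra).
  assert (Hb' : Rabs (G x - G t - g t * (x - t)) <= eps * - (x - t)) by (apply Hb; lra).
  apply Rabs_le_between in Ha'; apply Rabs_le_between in Hb'.
  apply Rabs_le; lra.
Qed.

Lemma hk_ftc A B G g : A <= B -> (forall x, derivable_pt_lim G x (g x)) ->
  HK_has_integral A B g (G B - G A).
Proof.
intros HAB HG eps Heps.
assert (He : 0 < eps / (B - A + 1)) by (apply Rdiv_lt_0_compat; lra).
destruct (straddle G g HG _ He) as [d [Hd H]].
exists d; split; [exact Hd|]. intros l Hl Hf.
apply Rle_lt_trans with (eps / (B - A + 1) * (B - A)).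
2:{ replace eps with (eps / (B - A + 1) * (B - A + 1)) at 2 by (field; lra). nra. }
clear HAB Heps. revert H He; generalize (eps / (B - A + 1)) as e; intros e H He.
revert A Hl Hf; induction l as [|[[x t] y] l IH]; simpl; intros A.
- intros -> _; replace (0 - (G B - G B)) with 0 by ring; rewrite Rabs_R0; lra.
- intros [-> [Ht Hl]] Hf; inversion Hf as [|? ? Hxy Hf']; subst.
  specialize (IH y Hl Hf').
  replace (g t * (y - A) + rsum g l - (G B - G A)) with
    ((g t * (y - A) - (G y - G A)) + (rsum g l - (G B - G y))) by ring.
  eapply Rle_trans; [apply Rabs_triang|].
  assert (Rabs (g t * (y - A) - (G y - G A)) <= e * (y - A)) by (apply H; lra).
  lra.
Qed.

(** The Riemann integral enters only here; with [hk_ftc] it makes continuous functions gauge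
    integrable. *)
Lemma continuous_primitive g : continuity g ->
  exists G, forall x, derivable_pt_lim G x (g x).
Proof.
intros Hg; exists (fun x => RInt g 0 x); intros x; apply is_derive_Reals.
apply is_derive_RInt with (a := 0).
- apply filter_forall; intros y; apply (@RInt_correct R_CompleteNormedModule), (@ex_RInt_continuous R_CompleteNormedModule).
  intros z _; apply continuity_pt_filterlim, Hg.
- apply continuity_pt_filterlim, Hg.
Qed.

Lemma continuity_intro (g : R -> R) :
  (forall x eps, 0 < eps -> exists d, 0 < d /\ forall y, Rabs (y - x) < d -> Rabs (g y - g x) < eps) ->
  continuity g.
Proof.
intros H x eps Heps; destruct (H x eps Heps) as [d [Hd Hy]].
exists d; split; [exact Hd|]. intros y [_ Hy']; now apply Hy.
Qed.

Lemma continuity_elim (g : R -> R) : continuity g ->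
  forall x eps, 0 < eps -> exists d, 0 < d /\ forall y, Rabs (y - x) < d -> Rabs (g y - g x) < eps.
Proof.
intros H x eps Heps; destruct (H x eps Heps) as [d [Hd Hy]].
exists d; split; [exact Hd|]. intros y Hyx.
destruct (Req_dec x y) as [->|Hn]; [rewrite Rminus_diag_eq, Rabs_R0; [exact Heps|reflexivity]|].
apply Hy; split; [split; [exact I|exact Hn]|exact Hyx].
Qed.

(** * Approximability implies integrability *)

(** Density of continuous functions in local L1, turned into a definition. Unlike gauge
    integrability it passes directly through Lipschitz operations, hence to norms and to products of
    bounded functions. *)
Definition approximable (f : R -> R) : Prop :=
  forall A B eps, A <= B -> 0 < eps ->
    exists g, continuity g /\ small A B (fun x => f x - g x) eps.

Lemma inv_S_bounds n : 0 < / INR (S n) <= 1.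
Proof.
split; [apply Rinv_0_lt_compat, lt_0_INR; lia|].
rewrite <- Rinv_1; apply Rinv_le_contravar; [lra|]. apply (le_INR 1); lia.
Qed.

Lemma inv_S_cv eps : 0 < eps -> exists N, forall n, (N <= n)%nat -> / INR (S n) < eps.
Proof.
intros He. destruct (archimed_cor1 eps He) as [N [HN HN0]]. exists N; intros n Hn.
apply Rle_lt_trans with (/ INR N); [|exact HN].
apply Rinv_le_contravar; [now apply lt_0_INR|apply le_INR; lia].
Qed.

(** Two approximants of [f] are close to each other in the sense of [small], so their integrals form
    a Cauchy sequence. The limit is the integral of [f], because Riemann sums of [f] and of a good
    approximant differ by less than any prescribed amount. *)
Lemma approx_integrable f A B : approximable f -> A <= B -> HK_integrable A B f.
Proof.
intros Hf HAB.
assert (Hn : forall n, exists p : (R -> R) * R, HK_has_integral A B (fst p) (snd p) /\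
          small A B (fun x => f x - fst p x) (/ INR (S n))).
{ intros n; destruct (Hf A B (/ INR (S n)) HAB) as [g [Hg Hs]].
  - apply inv_S_bounds.
  - destruct (continuous_primitive g Hg) as [G HG].
    exists (g, G B - G A); split; [now apply hk_ftc|exact Hs]. }
set (p := fun n => proj1_sig (constructive_indefinite_description _ (Hn n))).
assert (Hp : forall n, HK_has_integral A B (fst (p n)) (snd (p n)) /\
          small A B (fun x => f x - fst (p n) x) (/ INR (S n))).
{ intros n; unfold p; destruct constructive_indefinite_description as [q Hq]; exact Hq. }
clearbody p.
assert (Hc : Cauchy_crit (fun n => snd (p n))).
{ intros eps Heps. destruct (inv_S_cv (eps / 2)) as [N HN]; [lra|].
  exists N; intros n m Hnn Hm. unfold Rdist.
  destruct (Hp n) as [Hin Hsn]; destruct (Hp m) as [Him Hsm].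
  apply Rle_lt_trans with (/ INR (S n) + / INR (S m)).
  - apply small_int with (A := A) (B := B) (phi := fun x => 1 * fst (p n) x + (-1) * fst (p m) x).
    + exact HAB.
    + eapply small_add; [|exact Hsn|exact Hsm]. intros x _; simpl.
      replace (1 * fst (p n) x + -1 * fst (p m) x) with
       (- (f x - fst (p n) x) + (f x - fst (p m) x)) by ring.
      eapply Rle_trans; [apply Rabs_triang|rewrite Rabs_Ropp; lra].
    + replace (snd (p n) - snd (p m)) with (1 * snd (p n) + (-1) * snd (p m)) by ring.
      now apply hk_lin.
  - pose proof (HN n Hnn); pose proof (HN m Hm); lra. }
destruct (R_complete _ Hc) as [I HI]. exists I. intros eps Heps.
destruct (HI (eps / 3)) as [N1 HN1]; [lra|].
destruct (inv_S_cv (eps / 3)) as [N2 HN2]; [lra|].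
set (n := max N1 N2).
specialize (HN1 n ltac:(lia)). specialize (HN2 n ltac:(lia)). unfold Rdist in HN1.
destruct (Hp n) as [Hin Hsn].
destruct (Hin (eps / 3)) as [d1 [Hd1 H1]]; [lra|].
destruct (small_rsum _ _ _ _ Hsn) as [d2 [Hd2 H2]].
exists (fun t => Rmin (d1 t) (d2 t)); split; [now apply gauge_min|]. intros l Hl Hfi.
specialize (H1 l Hl (fine_min_l _ _ _ Hfi)).
specialize (H2 l Hl (fine_min_r _ _ _ Hfi)).
assert (Hrs : rsum (fun x => f x - fst (p n) x) l = rsum f l - rsum (fst (p n)) l).
{ clear. induction l as [|[[x t] y] l IH]; simpl; [ring|]. rewrite IH; ring. }
rewrite Hrs in H2.
apply Rabs_def2 in H1; apply Rabs_def2 in HN1; apply Rabs_le_between in H2.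
apply Rabs_def1; lra.
Qed.

(** * Approximation by continuous functions *)

(** Unlike [rsum], it accepts arbitrary functions of a tagged cell, as required for Henstock errors
    and for the energies [J x y ^ 2 / (y - x)]. *)
Definition qsum (q : R -> R -> R -> R) (l : list (R * R * R)) : R :=
  fold_right (fun p acc => match p with ((x, t), y) => q x t y + acc end) 0 l.

Lemma qsum_app q l1 l2 : qsum q (l1 ++ l2) = qsum q l1 + qsum q l2.
Proof.
induction l1 as [|[[x t] y] l IH]; simpl; [ring|rewrite IH; ring].
Qed.

Lemma qsum_ge0 q a b l : (forall x t y, x <= t -> t <= y -> 0 <= q x t y) ->
  tagged_div a b l -> 0 <= qsum q l.
Proof.
intros Hq; revert a; induction l as [|[[x t] y] l IH]; simpl; intros a; [lra|].
intros [-> [Ht Hl]]. specialize (IH y Hl). assert (0 <= q a t y) by (apply Hq; lra). lra.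
Qed.

(** [Phi x] is the supremum of [qsum q] over fine divisions of [[A, x]]. Appending one cell to such
    a division shows that the increments of [Phi] dominate [q]. This turns bounds on sums into the
    increment form demanded by [small]. *)
Lemma majorant (d : R -> R) (q : R -> R -> R -> R) A B eps :
  A <= B -> gauge d ->
  (forall x t y, x <= t -> t <= y -> 0 <= q x t y) ->
  (forall l, tagged_div A B l -> fine d l -> qsum q l <= eps) ->
  exists Phi : R -> R,
    (forall x y, A <= x -> x <= y -> y <= B -> Phi x <= Phi y) /\
    Phi B - Phi A <= eps /\
    forall x t y, A <= x -> x <= t -> t <= y -> y <= B -> t - d t < x -> y < t + d t ->
      q x t y <= Phi y - Phi x.
Proof.
intros HAB Hd Hq Hl.
set (E := fun x s => exists l, tagged_div A x l /\ fine d l /\ s = qsum q l).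
assert (Hext : forall x y l, tagged_div A x l -> fine d l -> x <= y ->
   exists l', tagged_div A y l' /\ fine d l' /\ qsum q l <= qsum q l').
{ intros x y l H1 H2 Hxy. destruct (cousin d x y Hd Hxy) as [l' [H3 H4]].
  exists (l ++ l'); repeat split.
  - now apply tagged_div_app with x.
  - now apply fine_app.
  - rewrite qsum_app. pose proof (qsum_ge0 q _ _ _ Hq H3). lra. }
(* Stated as an implication so that choice yields a total function; the value off [[A, B]] is
   arbitrary. *)
assert (Hs : forall x, exists s, A <= x <= B -> is_lub (E x) s).
{ intros x. destruct (Classical_Prop.classic (A <= x <= B)) as [Hx|Hx].
  - destruct (completeness (E x)) as [s Hs].
    + exists eps; intros s [l [H1 [H2 ->]]].
      destruct (Hext x B l H1 H2 (proj2 Hx)) as [l' [H3 [H4 H5]]].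
      specialize (Hl l' H3 H4). lra.
    + destruct (cousin d A x Hd (proj1 Hx)) as [l [H1 H2]]. exists (qsum q l), l; auto.
    + now exists s.
  - exists 0; tauto. }
set (Phi := fun x => proj1_sig (constructive_indefinite_description _ (Hs x))).
assert (HPhi : forall x, A <= x <= B -> is_lub (E x) (Phi x)).
{ intros x; unfold Phi; destruct constructive_indefinite_description as [s H]; exact H. }
clearbody Phi. exists Phi; repeat split.
- intros x y H1 H2 H3. apply (HPhi x); [lra|]. intros s [l [H4 [H5 ->]]].
  destruct (Hext x y l H4 H5 H2) as [l' [H6 [H7 H8]]].
  apply Rle_trans with (qsum q l'); [exact H8|]. apply (HPhi y); [lra|]. now exists l'.
- assert (0 <= Phi A).
  { apply (HPhi A); [lra|]. exists nil; repeat split. constructor. }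
  assert (Phi B <= eps); [|lra].
  apply (HPhi B); [lra|]. intros s [l [H4 [H5 ->]]]; now apply Hl.
- intros x t y H1 H2 H3 H4 H5 H6.
  assert (Phi x <= Phi y - q x t y); [|lra].
  apply (HPhi x); [lra|]. intros s [l [H7 [H8 ->]]].
  assert (qsum q (l ++ ((x, t), y) :: nil) <= Phi y).
  { apply (HPhi y); [lra|]. eexists; repeat split.
    - apply tagged_div_app with x; [exact H7|]. simpl; repeat split; lra.
    - apply fine_app; [exact H8|]. constructor; [lra|constructor]. }
  rewrite qsum_app in H; simpl in H. lra.
Qed.

(** * The Saks-Henstock lemma *)

(** Cells with nonnegative error are kept; each of the others is replaced by so fine a division that
    its error is negligible. The positive parts then sum, up to [eta], to the error of one single
    fine division, to which the hypothesis applies. *)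
Lemma henstock_pos (f : R -> R) (J : R -> R -> R) d A B eps :
  (forall x y, x <= y -> HK_has_integral x y f (J x y)) ->
  gauge d ->
  (forall l, tagged_div A B l -> fine d l -> Rabs (rsum f l - J A B) <= eps) ->
  forall l, tagged_div A B l -> fine d l ->
    qsum (fun x t y => Rmax 0 (f t * (y - x) - J x y)) l <= eps.
Proof.
intros HJ Hd Hb l Hl Hf.
assert (Hadd : forall x y z, x <= y -> y <= z -> J x z = J x y + J y z).
{ intros x y z Hxy Hyz. apply (hk_chasles x y z f); auto. apply HJ; lra. }
assert (H0 : forall x, J x x = 0).
{ intros x; apply (hk_unique x x f); [lra|apply HJ; lra|apply hk_point]. }
apply le_epsilon; intros eta Heta.
assert (Hmain : exists l', tagged_div A B l' /\ fine d l' /\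
  qsum (fun x t y => Rmax 0 (f t * (y - x) - J x y)) l - eta <= rsum f l' - J A B).
{ clear Hb; revert A eta Heta Hl Hf; induction l as [|[[x t] y] l IH]; simpl; intros A eta Heta.
  - intros -> _. exists nil; repeat split; [constructor|]. simpl; rewrite H0; lra.
  - intros [-> [Ht Hl]] Hf; inversion Hf as [|? ? Hxy Hf']; subst.
    pose proof (tagged_div_le _ _ _ Hl) as HyB.
    (* Half of the slack goes to the remaining cells and half to this one, so the total stays below
       [eta] for any number of cells. *)
    destruct (IH y (eta / 2) ltac:(lra) Hl Hf') as [l1 [H1 [H2 H3]]].
    rewrite (Hadd A y B) by lra.
    destruct (Rle_lt_dec 0 (f t * (y - A) - J A y)) as [Hs|Hs].
    + exists (((A, t), y) :: l1); repeat split; try lra; try exact H1.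
      * constructor; [lra|exact H2].
      * rewrite Rmax_right by exact Hs. simpl. lra.
    + destruct (HJ A y ltac:(lra) (eta / 2) ltac:(lra)) as [d' [Hd' Hi]].
      destruct (cousin _ A y (gauge_min _ _ Hd Hd') ltac:(lra)) as [l0 [Hl0 Hf0]].
      specialize (Hi l0 Hl0 (fine_min_r _ _ _ Hf0)). apply Rabs_def2 in Hi.
      exists (l0 ++ l1); repeat split.
      * now apply tagged_div_app with y.
      * apply fine_app; [exact (fine_min_l _ _ _ Hf0)|exact H2].
      * rewrite Rmax_left by lra. rewrite rsum_app. lra. }
destruct Hmain as [l' [H1 [H2 H3]]].
specialize (Hb l' H1 H2). apply Rabs_le_between in Hb. lra.
Qed.

(** Positive parts of the errors for [f] and for [- f] add up to absolute values, each contributing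
    at most [eps / 2]; [majorant] then supplies [Phi]. *)
Lemma henstock (f : R -> R) (J : R -> R -> R) A B eps :
  (forall x y, x <= y -> HK_has_integral x y f (J x y)) -> A <= B -> 0 < eps ->
  exists d Phi : R -> R, gauge d /\
    (forall x y, A <= x -> x <= y -> y <= B -> Phi x <= Phi y) /\
    Phi B - Phi A <= eps /\
    forall x t y, A <= x -> x <= t -> t <= y -> y <= B -> t - d t < x -> y < t + d t ->
      Rabs (f t * (y - x) - J x y) <= Phi y - Phi x.
Proof.
intros HJ HAB Heps.
destruct (HJ A B HAB (eps / 2)) as [d [Hd H]]; [lra|].
assert (HJ' : forall x y, x <= y -> HK_has_integral x y (fun t => - f t) (- J x y)).
{ intros x y Hxy. replace (- J x y) with ((-1) * J x y + 0 * J x y) by ring.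
  apply hk_ext with (fun t => (-1) * f t + 0 * f t); [intros; ring|].
  apply hk_lin; now apply HJ. }
exists d.
destruct (majorant d (fun x t y => Rabs (f t * (y - x) - J x y)) A B eps) as [Phi HPhi]; auto.
- intros; apply Rabs_pos.
- intros l Hl Hf.
  assert (H1 := henstock_pos f J d A B (eps / 2) HJ Hd).
  assert (H2 := henstock_pos (fun t => - f t) (fun x y => - J x y) d A B (eps / 2) HJ' Hd).
  specialize (fun h => H1 h l Hl Hf); specialize (fun h => H2 h l Hl Hf).
  replace (qsum _ l) with (qsum (fun x t y => Rmax 0 (f t * (y - x) - J x y)) l +
     qsum (fun x t y => Rmax 0 (- f t * (y - x) - - J x y)) l).
  + enough (qsum (fun x t y => Rmax 0 (f t * (y - x) - J x y)) l <= eps / 2 /\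
     qsum (fun x t y => Rmax 0 (- f t * (y - x) - - J x y)) l <= eps / 2) by lra.
    split; [apply H1|apply H2]; intros l' Hl' Hf'; specialize (H l' Hl' Hf').
    * lra.
    * replace (rsum (fun t => - f t) l') with (- rsum f l').
      { replace (- rsum f l' - - J A B) with (- (rsum f l' - J A B)) by ring.
        rewrite Rabs_Ropp; lra. }
      clear. induction l' as [|[[x t] y] l IH]; simpl; [ring|].
      rewrite <- IH; ring.
  + clear. induction l as [|[[x t] y] l IH]; simpl; [ring|].
    rewrite <- IH.
    replace (- f t * (y - x) - - J x y) with (- (f t * (y - x) - J x y)) by ring.
    set (u := f t * (y - x) - J x y).
    assert (Rabs u = Rmax 0 u + Rmax 0 (- u)); [|lra].
    unfold Rabs, Rmax; destruct (Rcase_abs u); repeat destruct Rle_dec; lra.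
- exists Phi; split; [exact Hd|exact HPhi].
Qed.

(** * Gluing approximants and the energy argument *)

Definition clamp (p q x : R) : R := Rmax p (Rmin q x).

Lemma clamp_lip p q x y : p <= q -> Rabs (clamp p q x - clamp p q y) <= Rabs (x - y).
Proof.
intros Hpq; unfold clamp, Rmax, Rmin, Rabs.
repeat destruct Rle_dec; repeat destruct Rcase_abs; lra.
Qed.

Lemma clamp_bound p q x : p <= q -> p <= clamp p q x <= q.
Proof. intros Hpq; unfold clamp, Rmax, Rmin; repeat destruct Rle_dec; lra. Qed.

Lemma clamp_id p q x : p <= x <= q -> clamp p q x = x.
Proof. intros Hpq; unfold clamp, Rmax, Rmin; repeat destruct Rle_dec; lra. Qed.

Lemma clamp_le p q x : p <= q -> x <= p -> clamp p q x = p.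
Proof. intros Hpq Hx; unfold clamp, Rmax, Rmin; repeat destruct Rle_dec; lra. Qed.

Lemma clamp_ge p q x : p <= q -> q <= x -> clamp p q x = q.
Proof. intros Hpq Hx; unfold clamp, Rmax, Rmin; repeat destruct Rle_dec; lra. Qed.

Lemma clamp_mono p q x y : p <= q -> x <= y -> clamp p q x <= clamp p q y.
Proof. intros Hpq Hx; unfold clamp, Rmax, Rmin; repeat destruct Rle_dec; lra. Qed.

Lemma continuity_lip (g : R -> R) L : 0 <= L ->
  (forall x y, Rabs (g x - g y) <= L * Rabs (x - y)) -> continuity g.
Proof.
intros HL Hg; apply continuity_intro; intros x eps Heps.
exists (eps / (L + 1)); split; [apply Rdiv_lt_0_compat; lra|]. intros y Hy.
apply Rle_lt_trans with (1 := Hg y x).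
assert (eps = (L + 1) * (eps / (L + 1))) by (field; lra).
pose proof (Rabs_pos (y - x)). nra.
Qed.

(** A linear ramp [r] of width [h] to the right of [q] passes from [g1] to [g2]. On the ramp the
    error is only known to be at most [2 * M], which is harmless because [h] is chosen after [M] and
    [th]. *)
Lemma glue A q B f g1 g2 M e1 e2 th :
  A <= q -> q <= B -> 0 <= M -> 0 < th ->
  (forall x, Rabs (f x) <= M) ->
  continuity g1 -> (forall x, Rabs (g1 x) <= M) ->
  continuity g2 -> (forall x, Rabs (g2 x) <= M) ->
  small A q (fun x => f x - g1 x) e1 -> small q B (fun x => f x - g2 x) e2 ->
  exists g, continuity g /\ (forall x, Rabs (g x) <= M) /\
    small A B (fun x => f x - g x) (e1 + e2 + th).
Proof.
intros HAq HqB HM Hth Hf Hg1 Hb1 Hg2 Hb2 [d1 [P1 [Hd1 [Hm1 [He1 H1]]]]] [d2 [P2 [Hd2 [Hm2 [He2 H2]]]]].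
set (h := th / (4 * M + 1)).
assert (Hh : 0 < h) by (apply Rdiv_lt_0_compat; lra).
assert (Hhth : 4 * M * h <= th).
{ assert (th = (4 * M + 1) * h) by (unfold h; field; lra). nra. }
set (r := fun t => clamp 0 1 ((t - q) / h)).
assert (Hr : continuity r).
{ apply continuity_lip with (/ h); [left; now apply Rinv_0_lt_compat|]. intros x y.
  eapply Rle_trans; [apply clamp_lip; lra|].
  replace ((x - q) / h - (y - q) / h) with (/ h * (x - y)) by (field; lra).
  rewrite Rabs_mult, (Rabs_right (/ h)); [lra|]. left; now apply Rinv_0_lt_compat. }
assert (Hr01 : forall t, 0 <= r t <= 1) by (intros t; apply clamp_bound; lra).
assert (Hr0 : forall t, t <= q -> r t = 0).
{ intros t Ht; apply clamp_le; [lra|]. apply Rmult_le_reg_r with h; [exact Hh|].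
  unfold Rdiv; rewrite Rmult_assoc, Rinv_l by lra; lra. }
assert (Hr1 : forall t, q + h <= t -> r t = 1).
{ intros t Ht; apply clamp_ge; [lra|]. apply Rmult_le_reg_r with h; [exact Hh|].
  unfold Rdiv; rewrite Rmult_assoc, Rinv_l by lra; lra. }
set (g := fun t => (1 - r t) * g1 t + r t * g2 t).
assert (Hg : continuity g).
{ unfold g. apply (continuity_plus (fun t => (1 - r t) * g1 t) (fun t => r t * g2 t)).
  - apply (continuity_mult (fun t => 1 - r t)); [|exact Hg1].
    apply (continuity_minus (fun _ => 1)); [|exact Hr]. apply continuity_const; now intros ??.
  - now apply continuity_mult. }
assert (HgM : forall x, Rabs (g x) <= M).
{ intros x; specialize (Hb1 x); specialize (Hb2 x); specialize (Hr01 x).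
  apply Rabs_le_between in Hb1; apply Rabs_le_between in Hb2. apply Rabs_le; unfold g; nra. }
exists g; split; [exact Hg|split; [exact HgM|]].
assert (Hfg : forall g' x, Rabs (g' x) <= M -> Rabs (f x - g' x) <= 2 * M).
{ intros g' x Hx; specialize (Hf x). apply Rabs_le_between in Hf; apply Rabs_le_between in Hx.
  apply Rabs_le; lra. }
(* Charges [2 * M] per unit length on [[q, q + 2 * h]]: one [h] for the ramp and one for the
   overhang of a cell tagged in it, whose reach the gauge limits to [h]. The total is
   [4 * M * h <= th]. *)
set (Z := clamp q (q + 2 * h)).
(* The entry [Rabs (t - q)] keeps a cell tagged away from [q] strictly on one side of [q]; at [q]
   itself any positive value will do. *)
exists (fun t => Rmin h (Rmin (d1 t) (Rmin (d2 t) (if Req_EM_T t q then 1 else Rabs (t - q))))).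
exists (fun x => P1 (Rmin x q) + P2 (Rmax x q) + 2 * M * Z x).
assert (HP1 : forall x y, A <= x -> x <= y -> P1 (Rmin x q) <= P1 (Rmin y q)).
{ intros x y Hx Hy; apply Hm1; [now apply Rmin_glb| |apply Rmin_r].
  apply Rmin_glb; [|apply Rmin_r]. eapply Rle_trans; [apply Rmin_l|exact Hy]. }
assert (HP2 : forall x y, x <= y -> y <= B -> P2 (Rmax x q) <= P2 (Rmax y q)).
{ intros x y Hx Hy; apply Hm2; [apply Rmax_r| |now apply Rmax_lub].
  apply Rmax_lub; [|apply Rmax_r]. eapply Rle_trans; [exact Hx|apply Rmax_l]. }
assert (HZ : forall x y, x <= y -> 2 * M * Z x <= 2 * M * Z y).
{ intros x y Hx; apply Rmult_le_compat_l; [lra|]. apply clamp_mono; lra. }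
repeat split.
- intros t; repeat apply Rmin_glb_lt; auto.
  destruct (Req_EM_T t q); [lra|]. apply Rabs_pos_lt; lra.
- intros x y Hx Hy HyB. specialize (HP1 x y Hx Hy); specialize (HP2 x y Hy HyB); specialize (HZ x y Hy). lra.
- rewrite (Rmin_left A q), (Rmax_right A q), (Rmin_right B q), (Rmax_left B q) by lra.
  assert (HZA := clamp_bound q (q + 2 * h) A ltac:(lra)).
  assert (HZB := clamp_bound q (q + 2 * h) B ltac:(lra)). fold Z in HZA, HZB. nra.
- intros x t y Hx Hxt Hty Hy.
  set (dd := Rmin h _).
  assert (D1 : dd <= h) by apply Rmin_l.
  assert (D2 : dd <= d1 t) by (eapply Rle_trans; [apply Rmin_r|apply Rmin_l]).
  assert (D3 : dd <= d2 t) by (eapply Rle_trans; [apply Rmin_r|eapply Rle_trans; [apply Rmin_r|apply Rmin_l]]).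
  assert (D4 : dd <= if Req_EM_T t q then 1 else Rabs (t - q))
    by (eapply Rle_trans; [apply Rmin_r|eapply Rle_trans; [apply Rmin_r|apply Rmin_r]]).
  clearbody dd. intros Hx' Hy'.
  specialize (HP1 x y Hx ltac:(lra)); specialize (HP2 x y ltac:(lra) Hy); specialize (HZ x y ltac:(lra)).
  destruct (Req_EM_T t q) as [->|Htq].
  (* A cell tagged [q] is split at [q]: [P1] pays for the left part, where [g q = g1 q], and [Z] for
     the right part. *)
  + assert (Hgq : g q = g1 q) by (unfold g; rewrite Hr0 by lra; ring). rewrite Hgq.
    assert (Rabs (f q - g1 q) * (q - x) <= P1 q - P1 x) by (apply H1; lra).
    assert (Rabs (f q - g1 q) <= 2 * M) by (apply Hfg; auto).
    rewrite (Rmin_left x q), (Rmin_right y q) in HP1 |- * by lra.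
    assert (Z y = y) by (apply clamp_id; lra).
    assert (Z x = q) by (apply clamp_le; lra).
    rewrite H3, H4. nra.
  + destruct (Rlt_le_dec t q) as [Hlt|Hge].
    * rewrite Rabs_left in D4 by lra.
      assert (Hgq : g t = g1 t) by (unfold g; rewrite Hr0 by lra; ring). rewrite Hgq.
      assert (Rabs (f t - g1 t) * (y - x) <= P1 y - P1 x) by (apply H1; lra).
      rewrite (Rmin_left x q), (Rmin_left y q) in HP1 |- * by lra. lra.
    * rewrite Rabs_right in D4 by lra. destruct (Rle_lt_dec (q + h) t) as [Hh1|Hh1].
      -- assert (Hgq : g t = g2 t) by (unfold g; rewrite Hr1 by lra; ring). rewrite Hgq.
         assert (Rabs (f t - g2 t) * (y - x) <= P2 y - P2 x) by (apply H2; lra).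
         rewrite (Rmax_left x q), (Rmax_left y q) in HP2 |- * by lra. lra.
      -- assert (Rabs (f t - g t) <= 2 * M) by (apply Hfg; auto).
         assert (Z y = y) by (apply clamp_id; lra).
         assert (Z x = x) by (apply clamp_id; lra). rewrite H0, H3 in HZ |- *. nra.
Qed.

(** The error against the mean value splits into [f t * (y - x) - J x y], paid by the Henstock
    majorant [PhiH], and [J x y - s * (y - x)], paid by the energy which [PhiE] gains on the cell
    beyond the energy of the undivided cell. If hardly any energy can be gained by refining, [f] is
    nearly constant on the cell in the L1 sense. *)
Lemma cell_small (f : R -> R) (J : R -> R -> R) d PhiH PhiE A B p q eta :
  0 < eta -> A <= p -> p < q -> q <= B ->
  (forall x y z, x <= y -> y <= z -> J x z = J x y + J y z) ->
  gauge d ->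
  (forall x y, A <= x -> x <= y -> y <= B -> PhiH x <= PhiH y) ->
  (forall x t y, A <= x -> x <= t -> t <= y -> y <= B -> t - d t < x -> y < t + d t ->
      Rabs (f t * (y - x) - J x y) <= PhiH y - PhiH x) ->
  (forall x y, A <= x -> x < y -> y <= B -> J x y ^ 2 / (y - x) <= PhiE y - PhiE x) ->
  small p q (fun x => f x - J p q / (q - p))
    (PhiH q - PhiH p + eta * (q - p) / 2 + (PhiE q - PhiE p - J p q ^ 2 / (q - p)) / (2 * eta)).
Proof.
intros Heta HAp Hpq HqB Hadd Hd Hm HH HE.
set (s := J p q / (q - p)).
(* Expanding [(J - s * h) ^ 2 / h = J ^ 2 / h - 2 * s * J + s ^ 2 * h] shows that the increments of
   [K] dominate the energies of [f - s]. Over the whole cell [K] increases by exactly the energy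
   surplus in the conclusion. *)
set (K := fun x => PhiE x - 2 * s * J p x + s ^ 2 * x).
assert (HJ0 : J p p = 0) by (assert (J p p = J p p + J p p) by (apply Hadd; lra); lra).
assert (HJ00 : forall x, J x x = 0).
{ intros x; assert (J x x = J x x + J x x) by (apply Hadd; lra); lra. }
assert (HK : forall x y, p <= x -> x < y -> y <= q -> (J x y - s * (y - x)) ^ 2 <= (y - x) * (K y - K x)).
{ intros x y Hx Hxy Hy. specialize (HE x y ltac:(lra) Hxy ltac:(lra)).
  unfold K; rewrite (Hadd p x y) by lra.
  assert (J x y ^ 2 <= (y - x) * (PhiE y - PhiE x)).
  { replace (J x y ^ 2) with ((y - x) * (J x y ^ 2 / (y - x))) by (field; lra).
    apply Rmult_le_compat_l; lra. }
  nra. }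
assert (HKm : forall x y, p <= x -> x <= y -> y <= q -> K x <= K y).
{ intros x y Hx Hxy Hy. destruct (Req_dec x y) as [->|Hn]; [lra|].
  specialize (HK x y Hx ltac:(lra) Hy). pose proof (pow2_ge_0 (J x y - s * (y - x))).
  apply Rnot_lt_le; intros Hlt. assert ((y - x) * (K x - K y) > 0) by (apply Rmult_lt_0_compat; lra). lra. }
(* AM-GM: [2 |J - s h| <= eta h + (J - s h)^2 / (h eta)] with [h = y - x]. *)
assert (HJs : forall x y, p <= x -> x <= y -> y <= q ->
  Rabs (J x y - s * (y - x)) <= eta * (y - x) / 2 + (K y - K x) / (2 * eta)).
{ intros x y Hx Hxy Hy. destruct (Req_dec x y) as [->|Hn].
  { rewrite HJ00. replace (0 - s * (y - y)) with 0 by ring. rewrite Rabs_R0.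
    replace (K y - K y) with 0 by ring. unfold Rdiv; lra. }
  specialize (HK x y Hx ltac:(lra) Hy). specialize (HKm x y Hx Hxy Hy).
  set (w := J x y - s * (y - x)) in *. set (k := K y - K x) in *. set (h := y - x) in *.
  assert (Hw : Rabs w ^ 2 = w ^ 2) by apply pow2_abs.
  pose proof (Rabs_pos w). set (u := Rabs w) in *.
  apply Rmult_le_reg_l with (2 * eta); [lra|].
  replace (2 * eta * (eta * h / 2 + k / (2 * eta))) with (eta ^ 2 * h + k) by (field; lra).
  assert (0 < h) by (unfold h; lra). assert (0 <= k) by (unfold k; lra).
  apply Rmult_le_reg_l with h; [lra|].
  assert (0 <= (eta * h - u) ^ 2) by apply pow2_ge_0. nra. }
exists d, (fun x => PhiH x + eta * x / 2 + K x / (2 * eta)); repeat split.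
- exact Hd.
- intros x y Hx Hxy Hy. specialize (HKm x y Hx Hxy Hy). specialize (Hm x y ltac:(lra) Hxy ltac:(lra)).
  assert (K x / (2 * eta) <= K y / (2 * eta)).
  { apply Rmult_le_compat_r; [left; apply Rinv_0_lt_compat; lra|lra]. }
  nra.
- right. assert (HKK : K q - K p = PhiE q - PhiE p - J p q ^ 2 / (q - p)).
  { unfold K; rewrite HJ0. unfold s. field; lra. }
  rewrite <- HKK. field; lra.
- intros x t y Hx Hxt Hty Hy Hdx Hdy.
  specialize (HJs x y Hx ltac:(lra) Hy). specialize (HH x t y ltac:(lra) Hxt Hty ltac:(lra) Hdx Hdy).
  replace (Rabs (f t - s) * (y - x)) with (Rabs ((f t * (y - x) - J x y) + (J x y - s * (y - x)))).
  + eapply Rle_trans; [apply Rabs_triang|]. unfold Rdiv in *; lra.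
  + replace (f t * (y - x) - J x y + (J x y - s * (y - x))) with ((f t - s) * (y - x)) by ring.
    rewrite Rabs_mult, (Rabs_right (y - x)); lra.
Qed.

(* Martingale argument: for [J x y] the integral of [f], the energies
   [sum J(I)^2 / |I|] increase under refinement and are at most [M^2 (B - A)];
   on a division of nearly maximal energy the step function of mean values is
   [L1]-close to [f]. *)
Lemma bounded_hk_approximable (f : R -> R) (M : R) :
  (forall x, Rabs (f x) <= M) ->
  (forall x y, x <= y -> HK_integrable x y f) -> approximable f.
Proof.
intros Hf Hint A B eps HAB Heps.
assert (HM : 0 <= M) by (specialize (Hf 0); pose proof (Rabs_pos (f 0)); lra).
set (J := fun x y => HK_int x y f).
assert (HJ : forall x y, x <= y -> HK_has_integral x y f (J x y)).
{ intros x y Hxy; apply hk_int_has, Hint, Hxy. }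
assert (Hadd : forall x y z, x <= y -> y <= z -> J x z = J x y + J y z).
{ intros x y z Hxy Hyz. apply (hk_chasles x y z f); auto. apply HJ; lra. }
assert (HJM : forall x y, x <= y -> Rabs (J x y) <= M * (y - x)).
{ intros x y Hxy; apply small_int with x y f; auto. apply small_const; auto. }
clearbody J.
set (q := fun x t y : R => J x y ^ 2 / (y - x)).
assert (Hq : forall x y, x <= y -> 0 <= J x y ^ 2 / (y - x) <= M ^ 2 * (y - x)).
{ intros x y Hxy. specialize (HJM x y Hxy). destruct (Req_dec x y) as [->|Hn].
  - assert (J y y = 0) by (assert (J y y = J y y + J y y) by (apply Hadd; lra); lra).
    rewrite H. unfold Rdiv. replace (0 ^ 2 * / (y - y)) with 0 by ring. nra.
  - split; [apply Rmult_le_pos; [apply pow2_ge_0|left; apply Rinv_0_lt_compat; lra]|].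
    apply Rmult_le_reg_l with (y - x); [lra|].
    replace ((y - x) * (J x y ^ 2 / (y - x))) with (J x y ^ 2) by (field; lra).
    apply Rabs_le_between in HJM. nra. }
set (E := fun s => exists l, tagged_div A B l /\ s = qsum q l).
assert (HqM : forall l x0, tagged_div x0 B l -> qsum q l <= M ^ 2 * (B - x0)).
{ induction l as [|[[x t] y] l IH]; simpl; intros x0; [intros ->; lra|].
  intros [-> [Ht Hl]]. specialize (IH y Hl). specialize (Hq x0 y ltac:(lra)). unfold q at 1. nra. }
destruct (completeness E) as [sE [Hub Hlub]].
{ exists (M ^ 2 * (B - A)); intros s [l [Hl ->]]; now apply HqM. }
{ destruct (cousin (fun _ => 1) A B ltac:(intros t; lra) HAB) as [l [Hl _]].
  exists (qsum q l), l; auto. }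
(* For a constant gauge above [B - A] every tagged division of [[A, B]] is fine, so the supremum of
   energies runs over all divisions. *)
destruct (majorant (fun _ => B - A + 1) q A B sE) as [PhiE [HmE [HtE HE]]]; auto.
{ intros t; lra. }
{ intros x t y Hx Hy; unfold q; apply Hq; lra. }
{ intros l Hl _; apply Hub; now exists l. }
(* The final error is at most [eta / 4] (Henstock) plus [eta * (B - A) / 2 + eta / 2] (energy) plus
   [eta / 4] (gluing), which is at most [eps]. The energy deficit is taken below [eta ^ 2] because
   [cell_small] divides it by [2 * eta]. *)
set (eta := eps / (B - A + 2)).
assert (Heta : 0 < eta) by (apply Rdiv_lt_0_compat; lra).
assert (Hpi : exists l, tagged_div A B l /\ sE - eta ^ 2 < qsum q l).
{ apply Classical_Prop.NNPP; intros Hn.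
  assert (sE <= sE - eta ^ 2); [|nra].
  apply Hlub; intros s [l [Hl ->]]. apply Rnot_lt_le; intros Hlt; apply Hn; now exists l. }
destruct Hpi as [l [Hl Hls]].
destruct (henstock f J A B (eta / 4) HJ HAB ltac:(lra)) as [d [PhiH [Hd [HmH [HtH HH]]]]].
(* The bounds of [cell_small] telescope: over a division they add up to the increment of [Psi] minus
   the energy of the division over [2 * eta]. *)
set (Psi := fun x => PhiH x + eta * x / 2 + PhiE x / (2 * eta)).
assert (Hmain : forall l p, A <= p -> tagged_div p B l -> forall th, 0 < th ->
  exists g, continuity g /\ (forall x, Rabs (g x) <= M) /\
    small p B (fun x => f x - g x) (Psi B - Psi p - qsum q l / (2 * eta) + th)).
{ clear l Hl Hls. induction l as [|[[x t] y] l IH]; simpl; intros p Hp.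
  - intros -> th Hth. exists (fun _ => 0); split; [|split].
    + apply continuity_const; now intros ??.
    + intros _; rewrite Rabs_R0; lra.
    + apply small_weaken with (M * (B - B)); [unfold Rdiv; lra|].
      apply small_const; auto. intros x _; rewrite Rminus_0_r; auto.
  - intros [-> [Ht Hl]] th Hth. pose proof (tagged_div_le _ _ _ Hl) as HyB.
    destruct (Req_dec p y) as [->|Hn].
    + destruct (IH y Hp Hl th Hth) as [g Hg]; exists g.
      assert (q y t y = 0).
      { unfold q. specialize (Hq y y ltac:(lra)). lra. }
      rewrite H, Rplus_0_l; exact Hg.
    + destruct (IH y ltac:(lra) Hl (th / 2) ltac:(lra)) as [g2 [Hg2 [Hb2 Hs2]]].
      assert (HEl : forall u v, A <= u -> u < v -> v <= B -> J u v ^ 2 / (v - u) <= PhiE v - PhiE u).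
      { intros u v Hu Huv Hv; apply (HE u u v); lra. }
      assert (Hs1 := cell_small f J d PhiH PhiE A B p y eta Heta Hp ltac:(lra) HyB Hadd Hd HmH HH HEl).
      assert (Hc1 : continuity (fun _ => J p y / (y - p))) by (apply continuity_const; now intros ??).
      assert (Hb1 : forall x : R, Rabs (J p y / (y - p)) <= M).
      { intros _. unfold Rdiv; rewrite Rabs_mult, Rabs_inv, (Rabs_right (y - p)) by lra.
        apply Rmult_le_reg_r with (y - p); [lra|].
        rewrite Rmult_assoc, Rinv_l by lra. rewrite Rmult_1_r. apply HJM; lra. }
      destruct (glue p y B f _ g2 M _ _ (th / 2)
         ltac:(lra) HyB HM ltac:(lra) Hf Hc1 Hb1 Hg2 Hb2 Hs1 Hs2) as [g [Hg1 [Hg3 Hg4]]].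
      exists g; split; [exact Hg1|split; [exact Hg3|]].
      eapply small_weaken; [|exact Hg4]. right. unfold Psi, q. field; lra. }
destruct (Hmain l A ltac:(lra) Hl (eta / 4) ltac:(lra)) as [g [Hg [_ Hs]]].
exists g; split; [exact Hg|]. eapply small_weaken; [|exact Hs].
unfold Psi.
assert ((PhiE B - PhiE A - qsum q l) / (2 * eta) <= eta / 2).
{ apply Rmult_le_reg_r with (2 * eta); [lra|].
  unfold Rdiv at 1; rewrite Rmult_assoc, Rinv_l by lra. lra. }
assert (eps = eta * (B - A + 2)) by (unfold eta; field; lra).
replace (PhiH B + eta * B / 2 + PhiE B / (2 * eta) - (PhiH A + eta * A / 2 + PhiE A / (2 * eta)) - qsum q l / (2 * eta) + eta / 4)
 with ((PhiH B - PhiH A) + eta * (B - A) / 2 + (PhiE B - PhiE A - qsum q l) / (2 * eta) + eta / 4) by (field; lra).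
nra.
Qed.

(** * Closure properties of approximable functions *)

Lemma approx_continuity f : continuity f -> approximable f.
Proof.
intros Hf A B eps HAB Heps; exists f; split; [exact Hf|].
apply small_weaken with (0 * (B - A)); [lra|]. apply small_const; [lra|].
intros x _; rewrite Rminus_diag_eq, Rabs_R0; [lra|reflexivity].
Qed.

Lemma approx_ext f g : (forall x, f x = g x) -> approximable f -> approximable g.
Proof.
intros Hfg Hf A B eps HAB Heps; destruct (Hf A B eps HAB Heps) as [h [Hh Hs]].
exists h; split; [exact Hh|]. eapply small_ext; [|exact Hs]. intros x _; simpl; now rewrite Hfg.
Qed.

(** Common source of closure under linear combinations, bounded products and the complex norm:
    applying [T] to the approximants multiplies the errors by at most [L]. *)
Lemma approx_lip2 (T : R -> R -> R) L f1 f2 : 0 <= L ->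
  (forall x y x' y', Rabs (T x y - T x' y') <= L * (Rabs (x - x') + Rabs (y - y'))) ->
  approximable f1 -> approximable f2 -> approximable (fun x => T (f1 x) (f2 x)).
Proof.
intros HL HT H1 H2 A B eps HAB Heps.
assert (He : 0 < eps / (2 * (L + 1))) by (apply Rdiv_lt_0_compat; lra).
destruct (H1 A B _ HAB He) as [g1 [Hg1 Hs1]]; destruct (H2 A B _ HAB He) as [g2 [Hg2 Hs2]].
exists (fun x => T (g1 x) (g2 x)); split.
- apply continuity_intro; intros x e' He'.
  assert (He2 : 0 < e' / (2 * (L + 1))) by (apply Rdiv_lt_0_compat; lra).
  destruct (continuity_elim _ Hg1 x _ He2) as [d1 [Hd1 Hc1]].
  destruct (continuity_elim _ Hg2 x _ He2) as [d2 [Hd2 Hc2]].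
  exists (Rmin d1 d2); split; [now apply Rmin_glb_lt|]. intros y Hy.
  specialize (Hc1 y (Rlt_le_trans _ _ _ Hy (Rmin_l _ _))).
  specialize (Hc2 y (Rlt_le_trans _ _ _ Hy (Rmin_r _ _))).
  eapply Rle_lt_trans; [apply HT|].
  assert (e' = 2 * (L + 1) * (e' / (2 * (L + 1)))) by (field; lra). nra.
- apply small_weaken with (L * (eps / (2 * (L + 1)) + eps / (2 * (L + 1)))).
  + assert (eps = 2 * (L + 1) * (eps / (2 * (L + 1)))) by (field; lra). nra.
  + apply small_dom with (fun x => Rabs (f1 x - g1 x) + Rabs (f2 x - g2 x)); [exact HL| |].
    * intros x _. eapply Rle_trans; [apply HT|]. apply Rmult_le_compat_l; [exact HL|apply Rle_abs].
    * apply small_add with (2 := Hs1) (3 := Hs2). intros x _.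
      rewrite Rabs_right; [lra|]. apply Rle_ge, Rplus_le_le_0_compat; apply Rabs_pos.
Qed.

Lemma approx_lin c d f g : approximable f -> approximable g -> approximable (fun x => c * f x + d * g x).
Proof.
apply (approx_lip2 (fun x y => c * x + d * y) (Rabs c + Rabs d)).
- pose proof (Rabs_pos c); pose proof (Rabs_pos d); lra.
- intros x y x' y'. replace (c * x + d * y - (c * x' + d * y')) with (c * (x - x') + d * (y - y')) by ring.
  eapply Rle_trans; [apply Rabs_triang|]. rewrite !Rabs_mult.
  pose proof (Rabs_pos c); pose proof (Rabs_pos d); pose proof (Rabs_pos (x - x')); pose proof (Rabs_pos (y - y')).
  nra.
Qed.

(** Multiplication is Lipschitz only on bounded sets; clamping to [[- M, M]] makes it globally so
    without changing the values of [f] and [g]. *)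
Lemma approx_mult M f g : (forall x, Rabs (f x) <= M) -> (forall x, Rabs (g x) <= M) ->
  approximable f -> approximable g -> approximable (fun x => f x * g x).
Proof.
intros Hf Hg Cf Cg.
assert (HM : 0 <= M) by (specialize (Hf 0); pose proof (Rabs_pos (f 0)); lra).
apply approx_ext with (fun x => clamp (- M) M (f x) * clamp (- M) M (g x)).
{ intros x; specialize (Hf x); specialize (Hg x).
  apply Rabs_le_between in Hf; apply Rabs_le_between in Hg. now rewrite !clamp_id by lra. }
apply (approx_lip2 (fun x y => clamp (- M) M x * clamp (- M) M y) M); auto.
intros x y x' y'.
replace (clamp (- M) M x * clamp (- M) M y - clamp (- M) M x' * clamp (- M) M y') with
  (clamp (- M) M y * (clamp (- M) M x - clamp (- M) M x') + clamp (- M) M x' * (clamp (- M) M y - clamp (- M) M y')) by ring.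
eapply Rle_trans; [apply Rabs_triang|]. rewrite !Rabs_mult, Rmult_plus_distr_l.
assert (Hb : forall z, Rabs (clamp (- M) M z) <= M).
{ intros z; apply Rabs_le. pose proof (clamp_bound (- M) M z ltac:(lra)). lra. }
apply Rplus_le_compat; apply Rmult_le_compat; try apply Rabs_pos; auto; apply clamp_lip; lra.
Qed.

Lemma approx_bounded_approx M f : (forall x, Rabs (f x) <= M) -> approximable f ->
  forall A B eps, A <= B -> 0 < eps ->
    exists g, continuity g /\ (forall x, Rabs (g x) <= M) /\ small A B (fun x => f x - g x) eps.
Proof.
intros HfM Hf A B eps HAB Heps; destruct (Hf A B eps HAB Heps) as [g [Hg Hs]].
assert (HM : 0 <= M) by (specialize (HfM 0); pose proof (Rabs_pos (f 0)); lra).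
exists (fun x => clamp (- M) M (g x)); split; [|split].
- apply (continuity_comp g (clamp (- M) M)); [exact Hg|].
  apply continuity_lip with 1; [lra|]. intros x y; rewrite Rmult_1_l; apply clamp_lip; lra.
- intros x; apply Rabs_le. pose proof (clamp_bound (- M) M (g x) ltac:(lra)). lra.
- apply small_weaken with (1 * eps); [lra|]. apply small_dom with (3 := Hs); [lra|].
  intros x _. rewrite Rmult_1_l. specialize (HfM x); apply Rabs_le_between in HfM.
  rewrite <- (clamp_id (- M) M (f x)) at 1 by lra. apply clamp_lip; lra.
Qed.

Lemma approx_reflect c f : approximable f -> approximable (fun x => f (c - x)).
Proof.
intros Hf A B eps HAB Heps; destruct (Hf (c - B) (c - A) eps ltac:(lra) Heps) as [g [Hg Hs]].
exists (fun x => g (c - x)); split.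
- apply (continuity_comp (fun x => c - x) g); [|exact Hg].
  apply continuity_lip with 1; [lra|]. intros x y.
  replace (c - x - (c - y)) with (- (x - y)) by ring. rewrite Rabs_Ropp; lra.
- apply (small_reflect _ _ _ _ c) in Hs.
  replace (c - (c - A)) with A in Hs by ring. now replace (c - (c - B)) with B in Hs by ring.
Qed.

(** The comparison function may depend on the interval and on the precision: [approx_conv] needs
    this freedom, since its comparison integral has a window adapted to [[A, B]]. *)
Lemma approx_uniform_limit f :
  (forall A B eps, A <= B -> 0 < eps ->
     exists h, approximable h /\ forall x, A <= x <= B -> Rabs (f x - h x) <= eps) -> approximable f.
Proof.
intros H A B eps HAB Heps.
assert (He : 0 < eps / (2 * (B - A + 1))) by (apply Rdiv_lt_0_compat; lra).
destruct (H A B _ HAB He) as [h [Hh Hfh]].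
destruct (Hh A B (eps / 2) HAB ltac:(lra)) as [g [Hg Hs]].
exists g; split; [exact Hg|].
apply small_weaken with (eps / (2 * (B - A + 1)) * (B - A) + eps / 2).
- assert (eps = 2 * (B - A + 1) * (eps / (2 * (B - A + 1)))) by (field; lra). nra.
- apply small_add with (fun x => f x - h x) (fun x => h x - g x); [| |exact Hs].
  + intros x _. replace (f x - g x) with ((f x - h x) + (h x - g x)) by ring. apply Rabs_triang.
  + apply small_const; [lra|exact Hfh].
Qed.

Lemma approx_sum (f : nat -> R -> R) N : (forall n, approximable (f n)) -> approximable (fun x => sum_f_R0 (fun n => f n x) N).
Proof.
intros Hf; induction N as [|N IH]; simpl; [apply Hf|].
apply approx_ext with (fun x => 1 * sum_f_R0 (fun n => f n x) N + 1 * f (S N) x); [intros; ring|].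
now apply approx_lin.
Qed.

(** * Integrals over the line and convolution *)

Lemma approx_int f A B : approximable f -> A <= B -> HK_has_integral A B f (HK_int A B f).
Proof. intros Hf HAB; now apply hk_int_has, approx_integrable. Qed.

Lemma approx_chasles f A B C : approximable f -> A <= B -> B <= C -> HK_int A C f = HK_int A B f + HK_int B C f.
Proof. intros Hf HAB HBC; apply (hk_chasles A B C f); auto; apply approx_int; auto; lra. Qed.

Lemma approx_int_bound f A B c : approximable f -> A <= B -> 0 <= c ->
  (forall x, A <= x <= B -> Rabs (f x) <= c) -> Rabs (HK_int A B f) <= c * (B - A).
Proof.
intros Hf HAB Hc Hb; apply small_int with A B f; auto; [now apply small_const|now apply approx_int].
Qed.

Lemma approx_int_lin c d f g A B : approximable f -> approximable g -> A <= B ->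
  HK_int A B (fun x => c * f x + d * g x) = c * HK_int A B f + d * HK_int A B g.
Proof. intros Hf Hg HAB; apply hk_int_eq; auto. apply hk_lin; now apply approx_int. Qed.

Definition vanishes_off (P Q : R) (f : R -> R) : Prop :=
  forall x, x <= P \/ Q <= x -> f x = 0.

Lemma approx_int_zero f A B : approximable f -> A <= B -> (forall x, A <= x <= B -> f x = 0) -> HK_int A B f = 0.
Proof.
intros Hf HAB H0. assert (H := approx_int_bound f A B 0 Hf HAB ltac:(lra)).
rewrite Rmult_0_l in H. apply Rabs_le_between in H; [lra|].
intros x Hx; rewrite H0 by exact Hx; rewrite Rabs_R0; lra.
Qed.

Lemma approx_int_widen f P Q P' Q' : approximable f -> P <= Q -> P' <= P -> Q <= Q' -> vanishes_off P Q f ->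
  HK_int P' Q' f = HK_int P Q f.
Proof.
intros Hf HPQ HP HQ Hv.
rewrite (approx_chasles f P' P Q'), (approx_chasles f P Q Q') by (auto; lra).
rewrite (approx_int_zero f P' P), (approx_int_zero f Q Q') by (auto; intros; apply Hv; lra). ring.
Qed.

Lemma rint_eq f I : Un_cv (fun n => HK_int (- INR n) (INR n) f) I -> Rint f = I.
Proof.
intros H; apply UL_sequence with (2 := H). exact (epsilon_spec (inhabits 0) _ (ex_intro _ I H)).
Qed.

(** The integrals over [[- n, n]] are eventually constant, so the [epsilon] in [Rint] has a genuine
    limit to pick. *)
Lemma rint_support f P Q : approximable f -> P <= Q -> vanishes_off P Q f -> Rint f = HK_int P Q f.
Proof.
intros Hf HPQ Hv; apply rint_eq. intros eps Heps.
destruct (INR_archimed 1 (Rabs P + Rabs Q)) as [N HN]; [lra|].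
exists N; intros n Hn. apply le_INR in Hn.
assert (HP := Rle_abs (- P)); rewrite Rabs_Ropp in HP. assert (HQ := Rle_abs Q).
pose proof (Rabs_pos P); pose proof (Rabs_pos Q).
rewrite (approx_int_widen f P Q) by (auto; lra).
unfold Rdist; rewrite Rminus_diag_eq, Rabs_R0; auto.
Qed.

Lemma rint_lin c d f g P Q : approximable f -> approximable g -> P <= Q -> vanishes_off P Q f -> vanishes_off P Q g ->
  Rint (fun x => c * f x + d * g x) = c * Rint f + d * Rint g.
Proof.
intros Hf Hg HPQ Hvf Hvg. rewrite (rint_support f P Q), (rint_support g P Q), (rint_support _ P Q); auto.
- now apply approx_int_lin.
- now apply approx_lin.
- intros x Hx; rewrite Hvf, Hvg by exact Hx; ring.
Qed.

Lemma approx_conv_integrand M f g xi :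
  (forall x, Rabs (f x) <= M) -> (forall x, Rabs (g x) <= M) ->
  approximable f -> approximable g -> approximable (fun eta => f eta * g (xi - eta)).
Proof.
intros Hf Hg Cf Cg; apply (approx_mult M f (fun eta => g (xi - eta))); auto.
now apply approx_reflect.
Qed.

Lemma conv_integrand_vanishes f g S xi P Q :
  (forall x, S <= Rabs x -> g x = 0) -> P <= xi - S -> xi + S <= Q ->
  vanishes_off P Q (fun eta => f eta * g (xi - eta)).
Proof.
intros Hg HP HQ x Hx. rewrite Hg; [ring|].
destruct Hx as [Hx|Hx].
- eapply Rle_trans; [|apply Rle_abs]; lra.
- rewrite <- Rabs_Ropp; eapply Rle_trans; [|apply Rle_abs]; lra.
Qed.

(* Approximating [g] alone in [L1] suffices, as [f] is bounded; for
   continuous [g] the integral depends continuously on [xi]. *)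
Lemma approx_conv M S f g : 0 < S ->
  (forall x, Rabs (f x) <= M) -> (forall x, Rabs (g x) <= M) ->
  (forall x, S <= Rabs x -> g x = 0) -> approximable f -> approximable g ->
  approximable (fun xi => Rint (fun eta => f eta * g (xi - eta))).
Proof.
intros HS Hf Hg Hv Cf Cg.
assert (HM : 0 <= M) by (specialize (Hf 0); pose proof (Rabs_pos (f 0)); lra).
apply approx_uniform_limit; intros A B eps HAB Heps.
(* One window for all [xi] in [[A, B]]: the integrand vanishes outside it, and [xi - eta] stays in
   [[A - Q, B - P]], where [g] is approximated. *)
set (P := A - S); set (Q := B + S). assert (HPQ : P <= Q) by (unfold P, Q; lra).
destruct (approx_bounded_approx M g Hg Cg (A - Q) (B - P) (eps / (M + 1))) as [k [Hk [HkM Hs]]].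
{ unfold P, Q; lra. } { apply Rdiv_lt_0_compat; lra. }
assert (Ck := approx_continuity k Hk).
exists (fun xi => HK_int P Q (fun eta => f eta * k (xi - eta))); split.
- apply approx_continuity, continuity_intro; intros x e He.
  set (e' := e / (M * (Q - P) + 1)).
  assert (HMPQ : 0 <= M * (Q - P)) by (apply Rmult_le_pos; lra).
  assert (He' : 0 < e') by (apply Rdiv_lt_0_compat; lra).
  (* The interval allows [xi] to move by at most 1 around [x], whence the [Rmin 1 d] below. *)
  destruct (Heine_cor2 (f := k) (a := x - 1 - Q) (b := x + 1 - P)) with (eps := mkposreal e' He') as [d Hd].
  { intros; apply Hk. }
  exists (Rmin 1 d); split; [apply Rmin_glb_lt; [lra|apply cond_pos]|]. intros y Hy.
  assert (Hy1 := Rlt_le_trans _ _ _ Hy (Rmin_l _ _)). assert (Hyd := Rlt_le_trans _ _ _ Hy (Rmin_r _ _)).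
  apply Rabs_def2 in Hy1.
  assert (Cy := approx_conv_integrand M f k y Hf HkM Cf Ck).
  assert (Cx := approx_conv_integrand M f k x Hf HkM Cf Ck).
  replace (HK_int P Q (fun eta => f eta * k (y - eta)) - HK_int P Q (fun eta => f eta * k (x - eta)))
    with (1 * HK_int P Q (fun eta => f eta * k (y - eta)) + (-1) * HK_int P Q (fun eta => f eta * k (x - eta))) by ring.
  rewrite <- approx_int_lin by auto.
  apply Rle_lt_trans with (M * e' * (Q - P)).
  + apply approx_int_bound; auto; [now apply approx_lin|apply Rmult_le_pos; lra|].
    intros z Hz. replace (1 * (f z * k (y - z)) + -1 * (f z * k (x - z))) with (f z * (k (y - z) - k (x - z))) by ring.
    rewrite Rabs_mult. apply Rmult_le_compat; auto using Rabs_pos.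
    left; apply Hd; try lra. now replace (y - z - (x - z)) with (y - x) by ring.
  + assert (e = (M * (Q - P) + 1) * e') by (unfold e'; field; lra). nra.
- intros xi Hxi. assert (Cg' := approx_conv_integrand M f g xi Hf Hg Cf Cg).
  assert (Ck' := approx_conv_integrand M f k xi Hf HkM Cf Ck).
  rewrite (rint_support _ P Q); auto.
  2:{ apply conv_integrand_vanishes with S; auto; unfold P, Q; lra. }
  replace (HK_int P Q (fun eta => f eta * g (xi - eta)) - HK_int P Q (fun eta => f eta * k (xi - eta)))
    with (1 * HK_int P Q (fun eta => f eta * g (xi - eta)) + (-1) * HK_int P Q (fun eta => f eta * k (xi - eta))) by ring.
  rewrite <- approx_int_lin by auto.
  apply Rle_trans with (M * (eps / (M + 1))).
  2:{ assert (eps = (M + 1) * (eps / (M + 1))) by (field; lra).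
      assert (0 < eps / (M + 1)) by (apply Rdiv_lt_0_compat; lra). nra. }
  apply small_int with P Q (fun eta => 1 * (f eta * g (xi - eta)) + -1 * (f eta * k (xi - eta))); auto.
  2:{ apply approx_int; auto. now apply approx_lin. }
  apply small_dom with (fun eta => g (xi - eta) - k (xi - eta)); auto.
  + intros z _. replace (1 * (f z * g (xi - z)) + -1 * (f z * k (xi - z))) with (f z * (g (xi - z) - k (xi - z))) by ring.
    rewrite Rabs_mult. apply Rmult_le_compat_r; auto using Rabs_pos.
  (* Reflection about [xi] gives smallness on an interval containing [[P, Q]]; monotonicity of [Phi]
     restricts it to the window. *)
  + apply (small_reflect _ _ _ _ xi) in Hs.
    destruct Hs as [d [Phi [Hd [Hm [He H]]]]]. exists d, Phi; repeat split; auto.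
    * intros; apply Hm; lra.
    * apply Rle_trans with (2 := He).
      assert (Phi Q <= Phi (xi - (A - Q))) by (apply Hm; lra).
      assert (Phi (xi - (B - P)) <= Phi P) by (apply Hm; lra). lra.
    * intros; apply H; lra.
Qed.

(** * Complex-valued functions *)

Lemma Cnorm_mul z w : Cnorm (Cmul z w) = Cnorm z * Cnorm w.
Proof. exact (Cmod_mult z w). Qed.

Lemma Cnorm_add z w : Cnorm (Cadd z w) <= Cnorm z + Cnorm w.
Proof. exact (Cmod_triangle z w). Qed.

Lemma Cnorm_ge_0 z : 0 <= Cnorm z.
Proof. apply sqrt_pos. Qed.

Lemma Cnorm_scal r z : Cnorm (Cscal r z) = Rabs r * Cnorm z.
Proof.
unfold Cnorm, Cscal; simpl Re; simpl Im.
replace ((r * Re z) ^ 2 + (r * Im z) ^ 2) with (r ^ 2 * (Re z ^ 2 + Im z ^ 2)) by ring.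
rewrite sqrt_mult.
- f_equal. rewrite <- Rsqr_pow2. apply sqrt_Rsqr_abs.
- apply pow2_ge_0.
- pose proof (pow2_ge_0 (Re z)); pose proof (pow2_ge_0 (Im z)); lra.
Qed.

Lemma Csub_add z w : Csub z w = Cadd z (Cscal (-1) w).
Proof. unfold Csub, Cadd, Cscal; simpl; f_equal; ring. Qed.

Lemma Cnorm_sub z w : Cnorm (Csub z w) <= Cnorm z + Cnorm w.
Proof.
rewrite Csub_add. eapply Rle_trans; [apply Cnorm_add|].
rewrite Cnorm_scal, Rabs_left; lra.
Qed.

Lemma Re_le_Cnorm z : Rabs (Re z) <= Cnorm z.
Proof.
unfold Cnorm; rewrite <- sqrt_Rsqr_abs; apply sqrt_le_1_alt.
rewrite Rsqr_pow2. pose proof (pow2_ge_0 (Im z)); lra.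
Qed.

Lemma Im_le_Cnorm z : Rabs (Im z) <= Cnorm z.
Proof.
unfold Cnorm; rewrite <- sqrt_Rsqr_abs; apply sqrt_le_1_alt.
rewrite Rsqr_pow2. pose proof (pow2_ge_0 (Re z)); lra.
Qed.

Lemma Cnorm_le_sum z : Cnorm z <= Rabs (Re z) + Rabs (Im z).
Proof.
pose proof (Rabs_pos (Re z)); pose proof (Rabs_pos (Im z)).
unfold Cnorm. rewrite <- (sqrt_pow2 (Rabs (Re z) + Rabs (Im z))) by lra.
apply sqrt_le_1_alt. rewrite <- (pow2_abs (Re z)), <- (pow2_abs (Im z)). nra.
Qed.

Lemma Cnorm_0 : Cnorm (0, 0) = 0.
Proof. unfold Cnorm; simpl. replace (0 * (0 * 1) + 0 * (0 * 1)) with 0 by ring. apply sqrt_0. Qed.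

Definition approximableC (f : R -> Cplx) : Prop :=
  approximable (fun x => Re (f x)) /\ approximable (fun x => Im (f x)).

Lemma approxC_norm f : approximableC f -> approximable (fun x => Cnorm (f x)).
Proof.
intros [H1 H2].
apply approx_ext with (fun x => Cnorm (Re (f x), Im (f x))); [intros x; now destruct (f x)|].
apply (approx_lip2 (fun x y => Cnorm (x, y)) 1 _ _); auto; [lra|].
intros x y x' y'.
assert (H : forall u v u' v', Cnorm (u, v) <= Cnorm (u', v') + (Rabs (u - u') + Rabs (v - v'))).
{ intros u v u' v'. replace (u, v) with (Cadd (u', v') (u - u', v - v')).
  - eapply Rle_trans; [apply Cnorm_add|]. apply Rplus_le_compat_l. apply (Cnorm_le_sum (u - u', v - v')).
  - unfold Cadd; simpl; f_equal; ring. }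
assert (Ha := H x y x' y'). assert (Hb := H x' y' x y).
rewrite (Rabs_minus_sym x' x), (Rabs_minus_sym y' y) in Hb.
apply Rabs_le; lra.
Qed.

Lemma approxC_sub f g : approximableC f -> approximableC g -> approximableC (fun x => Csub (f x) (g x)).
Proof.
intros [F1 F2] [G1 G2]; split.
- apply approx_ext with (fun x => 1 * Re (f x) + (-1) * Re (g x)); [intros x; simpl; ring|now apply approx_lin].
- apply approx_ext with (fun x => 1 * Im (f x) + (-1) * Im (g x)); [intros x; simpl; ring|now apply approx_lin].
Qed.

Lemma approxC_add f g : approximableC f -> approximableC g -> approximableC (fun x => Cadd (f x) (g x)).
Proof.
intros [F1 F2] [G1 G2]; split.
- apply approx_ext with (fun x => 1 * Re (f x) + 1 * Re (g x)); [intros x; simpl; ring|now apply approx_lin].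
- apply approx_ext with (fun x => 1 * Im (f x) + 1 * Im (g x)); [intros x; simpl; ring|now apply approx_lin].
Qed.

Lemma approxC_scal c f : approximableC f -> approximableC (fun x => Cscal c (f x)).
Proof.
intros [F1 F2]; split.
- apply approx_ext with (fun x => c * Re (f x) + 0 * Re (f x)); [intros x; simpl; ring|now apply approx_lin].
- apply approx_ext with (fun x => c * Im (f x) + 0 * Im (f x)); [intros x; simpl; ring|now apply approx_lin].
Qed.

(** * Weighted bounds and complex convolution *)

Lemma exp_le_mono x y : x <= y -> exp x <= exp y.
Proof. intros [H| ->]; [left; now apply exp_increasing|lra]. Qed.

Definition wt (a x : R) : R := exp (- a * Rabs x).

Definition bnd (a C : R) (f : R -> Cplx) : Prop := forall x, Cnorm (f x) <= C * wt a x.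

Definition csupp (S : R) (f : R -> Cplx) : Prop := forall x, S <= Rabs x -> f x = (0, 0).

Lemma wt_pos a x : 0 < wt a x.
Proof. apply exp_pos. Qed.

Lemma wt_le_1 a x : 0 <= a -> wt a x <= 1.
Proof.
intros Ha; unfold wt; rewrite <- exp_0. apply exp_le_mono. pose proof (Rabs_pos x). nra.
Qed.

Lemma wt_sub a x y : 0 <= a -> wt a y * wt a (x - y) <= wt a x.
Proof.
intros Ha; unfold wt; rewrite <- exp_plus. apply exp_le_mono.
assert (Rabs x <= Rabs y + Rabs (x - y)).
{ replace x with (y + (x - y)) at 1 by ring. apply Rabs_triang. }
nra.
Qed.

Lemma bnd_ge_0 a C f : bnd a C f -> 0 <= C.
Proof.
intros H; specialize (H 0). pose proof (Cnorm_ge_0 (f 0)). pose proof (wt_pos a 0).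
apply Rnot_lt_le; intros Hlt. nra.
Qed.

Lemma bnd_Cnorm a C f x : 0 <= a -> bnd a C f -> Cnorm (f x) <= C.
Proof.
intros Ha H. pose proof (bnd_ge_0 _ _ _ H). specialize (H x). pose proof (wt_le_1 a x Ha). nra.
Qed.

Lemma bnd_weaken a C C' f : C <= C' -> bnd a C f -> bnd a C' f.
Proof. intros HC H x; specialize (H x); pose proof (wt_pos a x); nra. Qed.

Lemma bnd_sub a C C' f g : bnd a C f -> bnd a C' g -> bnd a (C + C') (fun x => Csub (f x) (g x)).
Proof.
intros Hf Hg x; specialize (Hf x); specialize (Hg x).
eapply Rle_trans; [apply Cnorm_sub|]. lra.
Qed.

Lemma bnd_add a C C' f g : bnd a C f -> bnd a C' g -> bnd a (C + C') (fun x => Cadd (f x) (g x)).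
Proof.
intros Hf Hg x; specialize (Hf x); specialize (Hg x).
eapply Rle_trans; [apply Cnorm_add|]. lra.
Qed.

Lemma bnd_scal a C c f : bnd a C f -> bnd a (Rabs c * C) (fun x => Cscal c (f x)).
Proof.
intros Hf x; specialize (Hf x). rewrite Cnorm_scal. pose proof (Rabs_pos c). nra.
Qed.

Lemma csupp_sub S f g : csupp S f -> csupp S g -> csupp S (fun x => Csub (f x) (g x)).
Proof. intros Hf Hg x Hx; rewrite Hf, Hg by exact Hx. unfold Csub; simpl; f_equal; ring. Qed.

Lemma approxC_conv_integrand a C1 C2 f g xi : 0 <= a ->
  approximableC f -> approximableC g -> bnd a C1 f -> bnd a C2 g ->
  approximableC (fun eta => Cmul (f eta) (g (xi - eta))).
Proof.
intros Ha [F1 F2] [G1 G2] Hf Hg.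
assert (M1 : forall x, Cnorm (f x) <= Rmax C1 C2).
{ intros x; eapply Rle_trans; [eapply bnd_Cnorm; eauto|apply Rmax_l]. }
assert (M2 : forall x, Cnorm (g x) <= Rmax C1 C2).
{ intros x; eapply Rle_trans; [eapply bnd_Cnorm; eauto|apply Rmax_r]. }
assert (Rf := fun x => Rle_trans _ _ _ (Re_le_Cnorm (f x)) (M1 x)).
assert (If := fun x => Rle_trans _ _ _ (Im_le_Cnorm (f x)) (M1 x)).
assert (Rg := fun x => Rle_trans _ _ _ (Re_le_Cnorm (g x)) (M2 x)).
assert (Ig := fun x => Rle_trans _ _ _ (Im_le_Cnorm (g x)) (M2 x)).
split.
- apply approx_ext with (fun eta => 1 * (Re (f eta) * Re (g (xi - eta))) + (-1) * (Im (f eta) * Im (g (xi - eta)))).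
  { intros x; simpl; ring. }
  apply approx_lin; [exact (approx_conv_integrand _ (fun x => Re (f x)) (fun x => Re (g x)) xi Rf Rg F1 G1)
    |exact (approx_conv_integrand _ (fun x => Im (f x)) (fun x => Im (g x)) xi If Ig F2 G2)].
- apply approx_ext with (fun eta => 1 * (Re (f eta) * Im (g (xi - eta))) + 1 * (Im (f eta) * Re (g (xi - eta)))).
  { intros x; simpl; ring. }
  apply approx_lin; [exact (approx_conv_integrand _ (fun x => Re (f x)) (fun x => Im (g x)) xi Rf Ig F1 G2)
    |exact (approx_conv_integrand _ (fun x => Im (f x)) (fun x => Re (g x)) xi If Rg F2 G1)].
Qed.

(** Compact support is asked of the right factor, which in [convpow] is always the original
    function, so the growing supports of the powers are never tracked. *)
Lemma approxC_conv a S C1 C2 f g : 0 <= a -> 0 < S ->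
  approximableC f -> approximableC g -> bnd a C1 f -> bnd a C2 g -> csupp S g -> approximableC (conv f g).
Proof.
intros Ha HS [F1 F2] [G1 G2] Hf Hg Hv.
assert (M1 : forall x, Cnorm (f x) <= Rmax C1 C2).
{ intros x; eapply Rle_trans; [eapply bnd_Cnorm; eauto|apply Rmax_l]. }
assert (M2 : forall x, Cnorm (g x) <= Rmax C1 C2).
{ intros x; eapply Rle_trans; [eapply bnd_Cnorm; eauto|apply Rmax_r]. }
assert (Rf := fun x => Rle_trans _ _ _ (Re_le_Cnorm (f x)) (M1 x)).
assert (If := fun x => Rle_trans _ _ _ (Im_le_Cnorm (f x)) (M1 x)).
assert (Rg := fun x => Rle_trans _ _ _ (Re_le_Cnorm (g x)) (M2 x)).
assert (Ig := fun x => Rle_trans _ _ _ (Im_le_Cnorm (g x)) (M2 x)).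
assert (RV : forall x, S <= Rabs x -> Re (g x) = 0) by (intros x Hx; now rewrite Hv).
assert (IV : forall x, S <= Rabs x -> Im (g x) = 0) by (intros x Hx; now rewrite Hv).
pose (u f g := fun xi => Rint (fun eta => f eta * g (xi - eta))).
assert (Hlin : forall c d f1 f2 g1 g2 M,
  (forall x, Rabs (f1 x) <= M) -> (forall x, Rabs (f2 x) <= M) ->
  (forall x, Rabs (g1 x) <= M) -> (forall x, Rabs (g2 x) <= M) ->
  approximable f1 -> approximable f2 -> approximable g1 -> approximable g2 ->
  (forall x, S <= Rabs x -> g1 x = 0) -> (forall x, S <= Rabs x -> g2 x = 0) ->
  approximable (fun xi => / (2 * PI) * Rint (fun eta => c * (f1 eta * g1 (xi - eta)) + d * (f2 eta * g2 (xi - eta))))).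
{ intros c d f1 f2 g1 g2 M Bf1 Bf2 Bg1 Bg2 Cf1 Cf2 Cg1 Cg2 V1 V2.
  apply approx_ext with (fun xi => (/ (2 * PI) * c) * u f1 g1 xi + (/ (2 * PI) * d) * u f2 g2 xi).
  - intros xi. rewrite (rint_lin c d (fun eta => f1 eta * g1 (xi - eta)) (fun eta => f2 eta * g2 (xi - eta)) (xi - S) (xi + S)).
    + unfold u; ring.
    + now apply approx_conv_integrand with M.
    + now apply approx_conv_integrand with M.
    + lra.
    + apply conv_integrand_vanishes with S; auto; lra.
    + apply conv_integrand_vanishes with S; auto; lra.
  - apply approx_lin; unfold u; now apply approx_conv with M S. }
split.
- eapply approx_ext; [|apply (Hlin 1 (-1) (fun x => Re (f x)) (fun x => Im (f x)) (fun x => Re (g x)) (fun x => Im (g x)) (Rmax C1 C2)); auto].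
  intros xi; unfold conv, Cint, Cscal; simpl. f_equal; f_equal. apply functional_extensionality; intros eta; ring.
- eapply approx_ext; [|apply (Hlin 1 1 (fun x => Re (f x)) (fun x => Im (f x)) (fun x => Im (g x)) (fun x => Re (g x)) (Rmax C1 C2)); auto].
  intros xi; unfold conv, Cint, Cscal; simpl. f_equal; f_equal. apply functional_extensionality; intros eta; ring.
Qed.

Lemma Cmul_csupp S f g xi : csupp S g ->
  vanishes_off (xi - S) (xi + S) (fun eta => Re (Cmul (f eta) (g (xi - eta)))) /\
  vanishes_off (xi - S) (xi + S) (fun eta => Im (Cmul (f eta) (g (xi - eta)))).
Proof.
intros Hg.
assert (H : forall x, x <= xi - S \/ xi + S <= x -> g (xi - x) = (0, 0)).
{ intros x Hx; apply Hg; destruct Hx as [Hx|Hx].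
  - eapply Rle_trans; [|apply Rle_abs]; lra.
  - rewrite <- Rabs_Ropp; eapply Rle_trans; [|apply Rle_abs]; lra. }
split; intros x Hx; rewrite H by exact Hx; simpl; ring.
Qed.

(** The integrand is at most [C1 * C2 * wt a xi] on a window of length [2 * S]. Estimating real and
    imaginary parts separately costs a factor 2, and [/ (2 * PI) * (4 * S) <= 2 / 3 * S] since
    [PI > 3]. *)
Lemma bnd_conv a S C1 C2 f g : 0 <= a -> 0 < S ->
  approximableC f -> approximableC g -> bnd a C1 f -> bnd a C2 g -> csupp S g ->
  bnd a (2 / 3 * S * C1 * C2) (conv f g).
Proof.
intros Ha HS Cf Cg Hf Hg Hv xi.
destruct (approxC_conv_integrand a C1 C2 f g xi Ha Cf Cg Hf Hg) as [I1 I2].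
destruct (Cmul_csupp S f g xi Hv) as [V1 V2].
set (c := C1 * C2 * wt a xi).
assert (Hn : forall x, Cnorm (Cmul (f x) (g (xi - x))) <= c).
{ intros x; rewrite Cnorm_mul. assert (Hf' := Hf x); assert (Hg' := Hg (xi - x)).
  pose proof (Cnorm_ge_0 (f x)); pose proof (Cnorm_ge_0 (g (xi - x))).
  pose proof (wt_sub a xi x Ha).
  apply Rle_trans with ((C1 * wt a x) * (C2 * wt a (xi - x))).
  - apply Rmult_le_compat; auto.
  - replace (C1 * wt a x * (C2 * wt a (xi - x))) with (C1 * C2 * (wt a x * wt a (xi - x))) by ring.
    apply Rmult_le_compat_l; auto. apply Rmult_le_pos; [exact (bnd_ge_0 a C1 f Hf)|exact (bnd_ge_0 a C2 g Hg)]. }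
assert (Hc : 0 <= c) by (eapply Rle_trans; [apply (Cnorm_ge_0 (Cmul (f 0) (g (xi - 0))))|apply Hn]).
unfold conv; rewrite Cnorm_scal.
assert (HPI := PI2_3_2). pose proof PI_RGT_0.
rewrite Rabs_right by (left; apply Rinv_0_lt_compat; lra).
assert (HC : Cnorm (Cint (fun eta => Cmul (f eta) (g (xi - eta)))) <= 2 * (c * (2 * S))).
{ replace (2 * (c * (2 * S))) with (c * (xi + S - (xi - S)) + c * (xi + S - (xi - S))) by ring.
  eapply Rle_trans; [apply Cnorm_le_sum|]. apply Rplus_le_compat.
  - change (Rabs (Rint (fun eta => Re (Cmul (f eta) (g (xi - eta))))) <= c * (xi + S - (xi - S))).
    rewrite (rint_support _ (xi - S) (xi + S) I1 ltac:(lra) V1). apply approx_int_bound; auto; try lra.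
    intros x _. eapply Rle_trans; [apply Re_le_Cnorm|apply Hn].
  - change (Rabs (Rint (fun eta => Im (Cmul (f eta) (g (xi - eta))))) <= c * (xi + S - (xi - S))).
    rewrite (rint_support _ (xi - S) (xi + S) I2 ltac:(lra) V2). apply approx_int_bound; auto; try lra.
    intros x _. eapply Rle_trans; [apply Im_le_Cnorm|apply Hn]. }
apply Rle_trans with (/ (2 * PI) * (2 * (c * (2 * S)))).
- apply Rmult_le_compat_l; [left; apply Rinv_0_lt_compat; lra|exact HC].
- apply Rmult_le_reg_l with (2 * PI); [lra|]. rewrite <- Rmult_assoc, Rinv_r, Rmult_1_l by lra.
  replace (2 * PI * (2 / 3 * S * C1 * C2 * wt a xi)) with (4 / 3 * PI * (c * S)) by (unfold c; field).
  assert (0 <= c * S) by (apply Rmult_le_pos; lra). nra.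
Qed.

Lemma Cint_sub P Q h k : P <= Q -> approximableC h -> approximableC k ->
  vanishes_off P Q (fun x => Re (h x)) /\ vanishes_off P Q (fun x => Im (h x)) ->
  vanishes_off P Q (fun x => Re (k x)) /\ vanishes_off P Q (fun x => Im (k x)) ->
  Cint (fun x => Csub (h x) (k x)) = Csub (Cint h) (Cint k).
Proof.
intros HPQ [H1 H2] [K1 K2] [V1 V2] [W1 W2].
assert (E1 := rint_lin 1 (-1) _ _ P Q H1 K1 HPQ V1 W1).
assert (E2 := rint_lin 1 (-1) _ _ P Q H2 K2 HPQ V2 W2).
unfold Cint, Csub; apply injective_projections; simpl; unfold Rminus.
- replace (- Rint (fun x => Re (k x))) with (-1 * Rint (fun x => Re (k x))) by ring.
  rewrite <- (Rmult_1_l (Rint (fun x => Re (h x)))), <- E1.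
  f_equal; apply functional_extensionality; intros x; ring.
- replace (- Rint (fun x => Im (k x))) with (-1 * Rint (fun x => Im (k x))) by ring.
  rewrite <- (Rmult_1_l (Rint (fun x => Im (h x)))), <- E2.
  f_equal; apply functional_extensionality; intros x; ring.
Qed.

Lemma Cscal_sub c z w : Cscal c (Csub z w) = Csub (Cscal c z) (Cscal c w).
Proof. unfold Cscal, Csub; simpl; f_equal; ring. Qed.

Lemma conv_sub_l a S C1 C1' C2 f f' g xi : 0 <= a -> 0 < S ->
  approximableC f -> approximableC f' -> approximableC g -> bnd a C1 f -> bnd a C1' f' -> bnd a C2 g -> csupp S g ->
  conv (fun x => Csub (f x) (f' x)) g xi = Csub (conv f g xi) (conv f' g xi).
Proof.
intros Ha HS Cf Cf' Cg Hf Hf' Hg Hv.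
unfold conv; rewrite <- Cscal_sub, <- (Cint_sub (xi - S) (xi + S)).
- f_equal; f_equal; apply functional_extensionality; intros eta.
  unfold Cmul, Csub; simpl; f_equal; ring.
- lra.
- exact (approxC_conv_integrand a C1 C2 f g xi Ha Cf Cg Hf Hg).
- exact (approxC_conv_integrand a C1' C2 f' g xi Ha Cf' Cg Hf' Hg).
- now apply Cmul_csupp.
- now apply Cmul_csupp.
Qed.

Lemma conv_sub_r a S C1 C2 C2' f g g' xi : 0 <= a -> 0 < S ->
  approximableC f -> approximableC g -> approximableC g' -> bnd a C1 f -> bnd a C2 g -> bnd a C2' g' -> csupp S g -> csupp S g' ->
  conv f (fun x => Csub (g x) (g' x)) xi = Csub (conv f g xi) (conv f g' xi).
Proof.
intros Ha HS Cf Cg Cg' Hf Hg Hg' Hv Hv'.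
unfold conv; rewrite <- Cscal_sub, <- (Cint_sub (xi - S) (xi + S)).
- f_equal; f_equal; apply functional_extensionality; intros eta.
  unfold Cmul, Csub; simpl; f_equal; ring.
- lra.
- exact (approxC_conv_integrand a C1 C2 f g xi Ha Cf Cg Hf Hg).
- exact (approxC_conv_integrand a C1 C2' f g' xi Ha Cf Cg' Hf Hg').
- now apply Cmul_csupp.
- now apply Cmul_csupp.
Qed.

(** * The convolution exponential *)

Lemma geom_sum_le K N n : 0 <= K -> (N <= n)%nat ->
  sum_f_R0 (fun k => K * (1 / 6) ^ k) n <= sum_f_R0 (fun k => K * (1 / 6) ^ k) N + 6 / 5 * K * (1 / 6) ^ S N.
Proof.
intros HK HNn.
assert (H : forall m, sum_f_R0 (fun k => K * (1 / 6) ^ k) m = 6 / 5 * K * (1 - (1 / 6) ^ S m)).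
{ induction m as [|m IH]; [simpl; field|]. rewrite tech5, IH. simpl; field. }
rewrite !H. assert (0 < (1 / 6) ^ S n) by (apply pow_lt; lra). nra.
Qed.

(** The ratio [1 / 6] is the bound on q from [scaled_q_bounds], and [6 / 5] is the sum of the
    geometric series. *)
Lemma geometric_series (t : nat -> R) K : 0 <= K -> (forall k, Rabs (t k) <= K * (1 / 6) ^ k) ->
  exists s, infinite_sum t s /\ Rabs s <= 6 / 5 * K /\
    forall N, Rabs (s - sum_f_R0 t N) <= 6 / 5 * K * (1 / 6) ^ S N.
Proof.
intros HK Ht.
assert (Hd : forall N n, (N <= n)%nat -> Rabs (sum_f_R0 t n - sum_f_R0 t N) <= 6 / 5 * K * (1 / 6) ^ S N).
{ intros N n HNn.
  apply Rle_trans with (sum_f_R0 (fun k => K * (1 / 6) ^ k) n - sum_f_R0 (fun k => K * (1 / 6) ^ k) N).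
  - induction HNn as [|n HNn IH].
    + rewrite !Rminus_diag_eq, Rabs_R0; auto; lra.
    + rewrite !tech5.
      replace (sum_f_R0 t n + t (S n) - sum_f_R0 t N) with ((sum_f_R0 t n - sum_f_R0 t N) + t (S n)) by ring.
      eapply Rle_trans; [apply Rabs_triang|]. specialize (Ht (S n)). lra.
  - pose proof (geom_sum_le K N n HK HNn). lra. }
assert (Hp : forall eps, 0 < eps -> exists N, forall n, (N <= n)%nat -> 6 / 5 * K * (1 / 6) ^ S n < eps).
{ intros eps Heps. destruct (pow_lt_1_zero (1 / 6)) with (y := eps / (6 / 5 * K + 1)) as [N HN].
  - rewrite Rabs_right; lra.
  - apply Rdiv_lt_0_compat; lra.
  - exists N; intros n Hn. specialize (HN (S n) ltac:(lia)).
    assert (0 < (1 / 6) ^ S n) by (apply pow_lt; lra). rewrite Rabs_right in HN by lra.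
    assert (eps = (6 / 5 * K + 1) * (eps / (6 / 5 * K + 1))) by (field; lra). nra. }
assert (Hc : Cauchy_crit (sum_f_R0 t)).
{ intros eps Heps. destruct (Hp eps Heps) as [N HN]. exists N; intros n m Hn Hm. unfold Rdist.
  destruct (Nat.le_ge_cases n m) as [Hnm|Hnm].
  - rewrite Rabs_minus_sym. eapply Rle_lt_trans; [now apply Hd|]. now apply HN.
  - eapply Rle_lt_trans; [now apply Hd|]. now apply HN. }
destruct (R_complete _ Hc) as [s Hs].
assert (Hlim : forall N c r, (forall n, (N <= n)%nat -> Rabs (sum_f_R0 t n - c) <= r) -> Rabs (s - c) <= r).
{ intros N c r H. apply le_epsilon; intros eps Heps. destruct (Hs eps Heps) as [M HM].
  specialize (HM (max M N) ltac:(lia)). specialize (H (max M N) ltac:(lia)).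
  unfold Rdist in HM. rewrite Rabs_minus_sym in HM.
  replace (s - c) with ((s - sum_f_R0 t (max M N)) + (sum_f_R0 t (max M N) - c)) by ring.
  eapply Rle_trans; [apply Rabs_triang|]. lra. }
exists s; split; [exact Hs|split].
- replace s with (s - 0) by ring. apply (Hlim 0%nat). intros n _.
  rewrite Rminus_0_r. eapply Rle_trans; [apply Rsum_abs|].
  apply Rle_trans with (sum_f_R0 (fun k => K * (1 / 6) ^ k) n).
  + apply sum_Rle; intros; apply Ht.
  + pose proof (geom_sum_le K 0 n HK ltac:(lia)). simpl in H. lra.
- intros N; apply (Hlim N); intros n Hn; now apply Hd.
Qed.

(** Convertible to the components of [exp2star], so facts about it transfer without rewriting. *)
Definition series_val (t : nat -> R) : R := epsilon (inhabits 0) (infinite_sum t).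

Lemma series_val_eq t s : infinite_sum t s -> series_val t = s.
Proof.
intros H; apply (uniqueness_sum t); [|exact H].
exact (epsilon_spec (inhabits 0) _ (ex_intro _ s H)).
Qed.

Lemma series_val_bound t K : 0 <= K -> (forall k, Rabs (t k) <= K * (1 / 6) ^ k) ->
  Rabs (series_val t) <= 6 / 5 * K.
Proof.
intros HK Ht; destruct (geometric_series t K HK Ht) as [s [H1 [H2 _]]].
now rewrite (series_val_eq t s).
Qed.

Lemma series_val_sub t t' K : 0 <= K ->
  (forall k, Rabs (t k) <= K * (1 / 6) ^ k) -> (forall k, Rabs (t' k) <= K * (1 / 6) ^ k) ->
  series_val (fun k => t k - t' k) = series_val t - series_val t'.
Proof.
intros HK Ht Ht'; destruct (geometric_series t K HK Ht) as [s [H1 _]].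
destruct (geometric_series t' K HK Ht') as [s' [H1' _]].
rewrite (series_val_eq t s), (series_val_eq t' s') by assumption.
apply series_val_eq.
assert (H := CV_minus _ _ _ _ H1 H1').
intros eps Heps; destruct (H eps Heps) as [N HN]; exists N; intros n Hn.
specialize (HN n Hn). rewrite minus_sum. exact HN.
Qed.

Lemma approx_series (t : nat -> R -> R) K : 0 <= K -> (forall k, approximable (t k)) ->
  (forall k x, Rabs (t k x) <= K * (1 / 6) ^ k) -> approximable (fun x => series_val (fun k => t k x)).
Proof.
intros HK Hc Ht. apply approx_uniform_limit; intros A B eps HAB Heps.
destruct (pow_lt_1_zero (1 / 6)) with (y := eps / (6 / 5 * K + 1)) as [N HN].
{ rewrite Rabs_right; lra. } { apply Rdiv_lt_0_compat; lra. }
exists (fun x => sum_f_R0 (fun k => t k x) N); split; [now apply approx_sum|].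
intros x _. destruct (geometric_series (fun k => t k x) K HK (fun k => Ht k x)) as [s [H1 [_ H2]]].
rewrite (series_val_eq _ s H1). eapply Rle_trans; [apply H2|].
specialize (HN (S N) ltac:(lia)).
assert (0 < (1 / 6) ^ S N) by (apply pow_lt; lra). rewrite Rabs_right in HN by lra.
assert (eps = (6 / 5 * K + 1) * (eps / (6 / 5 * K + 1))) by (field; lra). nra.
Qed.

Lemma convpow_props a S B f k : 0 <= a -> 0 < S -> approximableC f -> bnd a B f -> csupp S f ->
  approximableC (convpow f k) /\ bnd a (B * (2 / 3 * S * B) ^ k) (convpow f k).
Proof.
intros Ha HS Cf Hf Hv; induction k as [|k [IH1 IH2]]; simpl convpow.
- split; [exact Cf|]. now rewrite pow_O, Rmult_1_r.
- split; [now apply (approxC_conv a S _ B _ _ Ha HS IH1 Cf IH2 Hf)|].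
  replace (B * (2 / 3 * S * B) ^ Datatypes.S k) with (2 / 3 * S * (B * (2 / 3 * S * B) ^ k) * B)
    by (rewrite <- tech_pow_Rmult; generalize ((2 / 3 * S * B) ^ k); intros; field).
  now apply bnd_conv.
Qed.

(** Split as (f - f') convolved with g, plus f' convolved with (g - g'). *)
Lemma bnd_conv_diff a S C1 C2 D1 D2 f f' g g' : 0 <= a -> 0 < S ->
  approximableC f -> approximableC f' -> approximableC g -> approximableC g' ->
  bnd a C1 f -> bnd a C1 f' -> bnd a C2 g -> bnd a C2 g' ->
  csupp S g -> csupp S g' ->
  bnd a D1 (fun x => Csub (f x) (f' x)) -> bnd a D2 (fun x => Csub (g x) (g' x)) ->
  bnd a (2 / 3 * S * (D1 * C2 + C1 * D2)) (fun x => Csub (conv f g x) (conv f' g' x)).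
Proof.
intros Ha HS Cf Cf' Cg Cg' Hf Hf' Hg Hg' Vg Vg' Hd1 Hd2 x.
replace (Csub (conv f g x) (conv f' g' x)) with
  (Cadd (conv (fun x => Csub (f x) (f' x)) g x) (conv f' (fun x => Csub (g x) (g' x)) x)).
- replace (2 / 3 * S * (D1 * C2 + C1 * D2)) with (2 / 3 * S * D1 * C2 + 2 / 3 * S * C1 * D2) by ring.
  apply (bnd_add a _ _ (conv (fun x => Csub (f x) (f' x)) g) (conv f' (fun x => Csub (g x) (g' x)))).
  + apply bnd_conv; auto using approxC_sub.
  + apply bnd_conv; auto using approxC_sub, csupp_sub.
- rewrite (conv_sub_l a S C1 C1 C2), (conv_sub_r a S C1 C2 C2) by auto.
  unfold Cadd, Csub; simpl; f_equal; ring.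
Qed.

(** The factor [k + 1] counts the positions at which the difference can sit when one power is
    changed into the other factor by factor. *)
Lemma convpow_diff a S B D f g k : 0 <= a -> 0 < S ->
  approximableC f -> approximableC g -> bnd a B f -> bnd a B g -> csupp S f -> csupp S g ->
  bnd a D (fun x => Csub (f x) (g x)) ->
  bnd a (INR (k + 1) * (2 / 3 * S * B) ^ k * D) (fun x => Csub (convpow f k x) (convpow g k x)).
Proof.
intros Ha HS Cf Cg Hf Hg Vf Vg HD; induction k as [|k IH]; simpl convpow.
- apply bnd_weaken with (2 := HD). simpl; lra.
- destruct (convpow_props a S B f k Ha HS Cf Hf Vf) as [C1 B1].
  destruct (convpow_props a S B g k Ha HS Cg Hg Vg) as [C2 B2].
  eapply bnd_weaken; [|now apply (bnd_conv_diff a S _ B _ D _ _ f g Ha HS C1 C2 Cf Cg B1 B2 Hf Hg Vf Vg IH HD)].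
  right. change (Datatypes.S k + 1)%nat with (Datatypes.S (k + 1)). rewrite S_INR, <- tech_pow_Rmult.
  generalize ((2 / 3 * S * B) ^ k); intros; field.
Qed.

Lemma fact_ge_2 k : 2 <= INR (fact (k + 2)).
Proof.
apply (le_INR 2). induction k as [|k IH]; [simpl; lia|].
change (fact (S k + 2)) with ((S (k + 2)) * fact (k + 2))%nat. nia.
Qed.

Lemma div_fact_le x K k : 0 <= K -> Rabs x <= K -> Rabs (x / INR (fact (k + 2))) <= K / 2.
Proof.
intros HK Hx. pose proof (fact_ge_2 k).
unfold Rdiv; rewrite Rabs_mult, Rabs_inv, (Rabs_right (INR _)) by lra.
apply Rmult_le_compat; auto using Rabs_pos.
- left; apply Rinv_0_lt_compat; lra.
- apply Rinv_le_contravar; lra.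
Qed.

(** The factorial absorbs the count [k + 2] coming from [convpow_diff], so the difference series is
    dominated by the same geometric series as the original one. *)
Lemma div_fact_le_pred x K k : 0 <= K -> Rabs x <= INR (k + 2) * K ->
  Rabs (x / INR (fact (k + 2))) <= K.
Proof.
intros HK Hx. pose proof (fact_ge_2 k).
unfold Rdiv; rewrite Rabs_mult, Rabs_inv, (Rabs_right (INR _)) by lra.
apply Rmult_le_reg_r with (INR (fact (k + 2))); [lra|].
rewrite Rmult_assoc, Rinv_l, Rmult_1_r by lra.
apply Rle_trans with (1 := Hx). rewrite Rmult_comm. apply Rmult_le_compat_l; [exact HK|].
apply le_INR. replace (k + 2)%nat with (S (k + 1)) by lia. simpl fact.
pose proof (lt_O_fact (k + 1)). nia.
Qed.

(** One factor [q] is kept exact and only the others are replaced by [1 / 6]: the retained [q] makes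
    the exponential term of second order in the size of the function. *)
Lemma pow_split_le q B w k : 0 <= q <= 1 / 6 -> 0 <= B -> 0 <= w <= 1 ->
  B * q ^ S k * w <= B * q * w * (1 / 6) ^ k.
Proof.
intros Hq HB Hw. rewrite <- tech_pow_Rmult.
assert (q ^ k <= (1 / 6) ^ k) by (apply pow_incr; lra).
assert (0 <= B * q * w) by (repeat apply Rmult_le_pos; lra). nra.
Qed.

(** The constant is 2 for the two components, times [1 / 2] from the factorials, times [6 / 5] from
    the geometric series. *)
Lemma exp2star_props a S B f : 0 <= a -> 0 < S -> approximableC f -> bnd a B f -> csupp S f ->
  2 / 3 * S * B <= 1 / 6 ->
  approximableC (exp2star f) /\ bnd a (6 / 5 * (B * (2 / 3 * S * B))) (exp2star f).
Proof.
intros Ha HS Cf Hf Hv Hq6. set (q := 2 / 3 * S * B) in *.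
assert (HB := bnd_ge_0 _ _ _ Hf).
assert (Hq : 0 <= q <= 1 / 6) by (split; [unfold q; repeat apply Rmult_le_pos; lra|exact Hq6]).
assert (Hk : forall k x, Cnorm (convpow f (Datatypes.S k) x) <= B * q * wt a x * (1 / 6) ^ k).
{ intros k x. destruct (convpow_props a S B f (Datatypes.S k) Ha HS Cf Hf Hv) as [_ H].
  eapply Rle_trans; [apply H|]. fold q. apply pow_split_le; auto.
  pose proof (wt_pos a x); pose proof (wt_le_1 a x Ha); lra. }
assert (HK : forall x k, 0 <= B * q * wt a x * (1 / 6) ^ k).
{ intros x k; eapply Rle_trans; [apply Cnorm_ge_0|apply Hk]. }
assert (HR : forall x k, Rabs (Re (convpow f (Datatypes.S k) x) / INR (fact (k + 2))) <= B * q * wt a x / 2 * (1 / 6) ^ k).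
{ intros x k. replace (B * q * wt a x / 2 * (1 / 6) ^ k) with (B * q * wt a x * (1 / 6) ^ k / 2) by field.
  apply div_fact_le; auto. eapply Rle_trans; [apply Re_le_Cnorm|apply Hk]. }
assert (HI : forall x k, Rabs (Im (convpow f (Datatypes.S k) x) / INR (fact (k + 2))) <= B * q * wt a x / 2 * (1 / 6) ^ k).
{ intros x k. replace (B * q * wt a x / 2 * (1 / 6) ^ k) with (B * q * wt a x * (1 / 6) ^ k / 2) by field.
  apply div_fact_le; auto. eapply Rle_trans; [apply Im_le_Cnorm|apply Hk]. }
assert (HBq : 0 <= B * q) by (apply Rmult_le_pos; lra).
assert (Hw : forall x k, B * q * wt a x / 2 * (1 / 6) ^ k <= B * q / 2 * (1 / 6) ^ k).
{ intros x k. apply Rmult_le_compat_r; [apply pow_le; lra|].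
  pose proof (wt_le_1 a x Ha). nra. }
assert (Hcls : forall (p : Cplx -> R), (forall k, approximable (fun x => p (convpow f (Datatypes.S k) x))) ->
   forall k, approximable (fun x => p (convpow f (Datatypes.S k) x) / INR (fact (k + 2)))).
{ intros p Hp k.
  apply approx_ext with (fun x => / INR (fact (k + 2)) * p (convpow f (Datatypes.S k) x) + 0 * p (convpow f (Datatypes.S k) x)).
  - intros x; unfold Rdiv; ring.
  - now apply approx_lin. }
split; [split|].
- apply (approx_series (fun k x => Re (convpow f (Datatypes.S k) x) / INR (fact (k + 2))) (B * q / 2)); [lra| |].
  + apply Hcls; intros k; apply (convpow_props a S B f (Datatypes.S k) Ha HS Cf Hf Hv).
  + intros k x; eapply Rle_trans; [apply HR|apply Hw].
- apply (approx_series (fun k x => Im (convpow f (Datatypes.S k) x) / INR (fact (k + 2))) (B * q / 2)); [lra| |].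
  + apply Hcls; intros k; apply (convpow_props a S B f (Datatypes.S k) Ha HS Cf Hf Hv).
  + intros k x; eapply Rle_trans; [apply HI|apply Hw].
- intros x. assert (HKx := HK x O). rewrite pow_O, Rmult_1_r in HKx.
  eapply Rle_trans; [apply Cnorm_le_sum|].
  assert (H1 := series_val_bound _ (B * q * wt a x / 2) ltac:(lra) (HR x)).
  assert (H2 := series_val_bound _ (B * q * wt a x / 2) ltac:(lra) (HI x)).
  apply Rle_trans with (6 / 5 * (B * q * wt a x / 2) + 6 / 5 * (B * q * wt a x / 2)); [|lra].
  exact (Rplus_le_compat _ _ _ _ H1 H2).
Qed.

(** As for the bound itself, except that the factorial is spent on the count of [convpow_diff]; the
    saved [1 / 2] is lost and [6 / 5] becomes [12 / 5]. *)
Lemma exp2star_diff a S B D f g : 0 <= a -> 0 < S ->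
  approximableC f -> approximableC g -> bnd a B f -> bnd a B g -> csupp S f -> csupp S g ->
  2 / 3 * S * B <= 1 / 6 ->
  bnd a D (fun x => Csub (f x) (g x)) ->
  bnd a (12 / 5 * (2 / 3 * S * B) * D) (fun x => Csub (exp2star f x) (exp2star g x)).
Proof.
intros Ha HS Cf Cg Hf Hg Vf Vg Hq6 HD. set (q := 2 / 3 * S * B) in *.
assert (HB := bnd_ge_0 _ _ _ Hf). assert (HD0 := bnd_ge_0 _ _ _ HD).
assert (Hq : 0 <= q <= 1 / 6) by (split; [unfold q; repeat apply Rmult_le_pos; lra|exact Hq6]).
intros x. pose proof (wt_pos a x) as Hw0. pose proof (wt_le_1 a x Ha) as Hw1.
assert (Hb : forall h, approximableC h -> bnd a B h -> csupp S h -> forall k,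
  Cnorm (convpow h (Datatypes.S k) x) <= B * q * wt a x * (1 / 6) ^ k).
{ intros h Ch Hh Vh k. destruct (convpow_props a S B h (Datatypes.S k) Ha HS Ch Hh Vh) as [_ H].
  eapply Rle_trans; [apply H|]. fold q. apply pow_split_le; auto; lra. }
assert (Hk : forall k, Cnorm (Csub (convpow f (Datatypes.S k) x) (convpow g (Datatypes.S k) x))
   <= INR (k + 2) * (q * D * wt a x * (1 / 6) ^ k)).
{ intros k. eapply Rle_trans; [apply (convpow_diff a S B D f g (Datatypes.S k)); auto|]. fold q.
  replace (Datatypes.S k + 1)%nat with (k + 2)%nat by lia.
  rewrite !Rmult_assoc; apply Rmult_le_compat_l; [apply pos_INR|].
  pose proof (pow_split_le q D (wt a x) k Hq HD0 ltac:(lra)). lra. }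
assert (HBq : 0 <= B * q * wt a x) by (repeat apply Rmult_le_pos; lra).
assert (HDq : 0 <= q * D * wt a x) by (repeat apply Rmult_le_pos; lra).
assert (Hp : forall k, 0 <= (1 / 6) ^ k) by (intros k; apply pow_le; lra).
assert (Hmain : forall p : Cplx -> R, (forall z, Rabs (p z) <= Cnorm z) ->
   (forall z w, p (Csub z w) = p z - p w) ->
   Rabs (series_val (fun k => p (convpow f (Datatypes.S k) x) / INR (fact (k + 2))) -
         series_val (fun k => p (convpow g (Datatypes.S k) x) / INR (fact (k + 2)))) <= 6 / 5 * (q * D * wt a x)).
{ intros p Hpn Hps.
  rewrite <- (series_val_sub _ _ (B * q * wt a x)); auto.
  - apply series_val_bound; auto. intros k.
    replace (p (convpow f (Datatypes.S k) x) / INR (fact (k + 2)) - p (convpow g (Datatypes.S k) x) / INR (fact (k + 2)))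
      with (p (Csub (convpow f (Datatypes.S k) x) (convpow g (Datatypes.S k) x)) / INR (fact (k + 2)))
      by (rewrite Hps; unfold Rdiv; ring).
    apply div_fact_le_pred; [now apply Rmult_le_pos|]. eapply Rle_trans; [apply Hpn|apply Hk].
  - intros k; eapply Rle_trans; [apply div_fact_le with (K := B * q * wt a x * (1 / 6) ^ k)|].
    + now apply Rmult_le_pos.
    + eapply Rle_trans; [apply Hpn|now apply Hb].
    + specialize (Hp k). nra.
  - intros k; eapply Rle_trans; [apply div_fact_le with (K := B * q * wt a x * (1 / 6) ^ k)|].
    + now apply Rmult_le_pos.
    + eapply Rle_trans; [apply Hpn|now apply Hb].
    + specialize (Hp k). nra. }
eapply Rle_trans; [apply Cnorm_le_sum|].
assert (H1 := Hmain Re Re_le_Cnorm ltac:(reflexivity)).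
assert (H2 := Hmain Im Im_le_Cnorm ltac:(reflexivity)).
apply Rle_trans with (6 / 5 * (q * D * wt a x) + 6 / 5 * (q * D * wt a x)); [|lra].
exact (Rplus_le_compat _ _ _ _ H1 H2).
Qed.

(** * The operator R *)

Lemma sqrt2_bounds : 1 <= sqrt 2 <= 3 / 2.
Proof.
split.
- rewrite <- sqrt_1 at 1. apply sqrt_le_1_alt; lra.
- rewrite <- (sqrt_pow2 (3 / 2)) by lra. apply sqrt_le_1_alt; lra.
Qed.

Lemma cutoff_nonzero lam b x : 0 < lam -> cutoff lam b -> b x <> 0 ->
  Rabs x <= 3 / 2 * lam /\ x ^ 2 < 2 * lam ^ 2.
Proof.
intros Hl [_ [_ [_ Hb]]] Hx.
assert (H : Rabs x < sqrt 2 * lam) by (apply Rnot_le_lt; intros H; now apply Hx, Hb).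
pose proof sqrt2_bounds. pose proof (Rabs_pos x). split; [nra|].
rewrite <- pow2_abs. assert (H2 : sqrt 2 * sqrt 2 = 2) by (apply sqrt_sqrt; lra).
replace (2 * lam ^ 2) with ((sqrt 2 * lam) ^ 2) by (rewrite <- H2 at 2; ring).
simpl; nra.
Qed.

Lemma cutoff_continuity lam b : cutoff lam b -> continuity b.
Proof.
intros [[D [<- HD]] _]. apply derivable_continuous; intros x; exists (D 1%nat x); apply HD.
Qed.

Lemma weight_bound lam b x : 0 < lam -> cutoff lam b ->
  Rabs (b x / (4 * lam ^ 2 - x ^ 2)) <= / (2 * lam ^ 2).
Proof.
intros Hl Hb. assert (Hl2 : 0 < lam ^ 2) by now apply pow_lt.
destruct (Req_dec (b x) 0) as [->|Hx].
- unfold Rdiv; rewrite Rmult_0_l, Rabs_R0. left; apply Rinv_0_lt_compat; lra.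
- destruct (cutoff_nonzero lam b x Hl Hb Hx) as [_ H2].
  destruct Hb as [_ [H01 _]]. specialize (H01 x).
  rewrite Rabs_right.
  + rewrite <- (Rmult_1_l (/ (2 * lam ^ 2))). apply Rmult_le_compat; try lra.
    * left; apply Rinv_0_lt_compat; lra.
    * apply Rinv_le_contravar; lra.
  + apply Rle_ge, Rmult_le_pos; [lra|]. left; apply Rinv_0_lt_compat; lra.
Qed.

Lemma weight_continuity lam b h : 0 < lam -> cutoff lam b -> continuity h ->
  continuity (fun x => h x * (b x / (4 * lam ^ 2 - x ^ 2))).
Proof.
intros Hl Hb Hh. assert (Hl2 : 0 < lam ^ 2) by now apply pow_lt.
(* This is the maximum of [2 * lam ^ 2] and [4 * lam ^ 2 - x ^ 2]: continuous, positive even at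
   [|x| = 2 * lam] where the true denominator vanishes, and equal to that denominator wherever [b]
   is nonzero. *)
set (u := fun x => 2 * lam ^ 2 + (Rabs (2 * lam ^ 2 - x ^ 2) + (2 * lam ^ 2 - x ^ 2)) / 2).
assert (Hu : forall x, 0 < u x).
{ intros x; unfold u. pose proof (Rle_abs (- (2 * lam ^ 2 - x ^ 2))) as H. rewrite Rabs_Ropp in H. lra. }
replace (fun x => h x * (b x / (4 * lam ^ 2 - x ^ 2))) with (h * (b / u))%F.
- apply continuity_mult; [exact Hh|]. apply continuity_div.
  + now apply cutoff_continuity with lam.
  + assert (Hc : continuity (fun x => 2 * lam ^ 2 - x ^ 2)) by reg.
    assert (Hk : forall c : R, continuity (fun _ => c)) by (intros c; apply continuity_const; now intros ??).
    apply (continuity_plus (fun _ => 2 * lam ^ 2)); [apply Hk|].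
    apply (continuity_mult (fun x => Rabs (2 * lam ^ 2 - x ^ 2) + (2 * lam ^ 2 - x ^ 2))); [|apply Hk].
    apply (continuity_plus (fun x => Rabs (2 * lam ^ 2 - x ^ 2))); [|exact Hc].
    exact (continuity_comp _ Rabs Hc Rcontinuity_abs).
  + intros x; specialize (Hu x); lra.
- apply functional_extensionality; intros x; unfold mult_fct, div_fct. f_equal.
  destruct (Req_dec (b x) 0) as [->|Hx]; [unfold Rdiv; ring|].
  destruct (cutoff_nonzero lam b x Hl Hb Hx) as [_ H2].
  f_equal. unfold u. rewrite Rabs_right by lra. field.
Qed.

Lemma approxC_weight a K C c f : 0 <= a -> continuity c -> (forall x, Rabs (c x) <= K) ->
  approximableC f -> bnd a C f -> approximableC (fun x => Cscal (c x) (f x)) /\ bnd a (K * C) (fun x => Cscal (c x) (f x)).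
Proof.
intros Ha Hc HK [F1 F2] Hf. assert (Cc := approx_continuity c Hc).
assert (M1 : forall x, Rabs (c x) <= Rmax K C) by (intros x; eapply Rle_trans; [apply HK|apply Rmax_l]).
assert (M2 : forall x, Cnorm (f x) <= Rmax K C).
{ intros x; eapply Rle_trans; [exact (bnd_Cnorm a C f x Ha Hf)|apply Rmax_r]. }
split; [split|].
- apply (approx_mult (Rmax K C) c (fun x => Re (f x))); auto.
  intros x; eapply Rle_trans; [apply Re_le_Cnorm|apply M2].
- apply (approx_mult (Rmax K C) c (fun x => Im (f x))); auto.
  intros x; eapply Rle_trans; [apply Im_le_Cnorm|apply M2].
- intros x; rewrite Cnorm_scal, Rmult_assoc. apply Rmult_le_compat; auto using Rabs_pos, Cnorm_ge_0.
Qed.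

Lemma Wb_props a C lam b f : 0 <= a -> 0 < lam -> cutoff lam b -> approximableC f -> bnd a C f ->
  approximableC (Wb lam b f) /\ bnd a (/ (2 * lam ^ 2) * C) (Wb lam b f) /\ csupp (sqrt 2 * lam) (Wb lam b f).
Proof.
intros Ha Hl Hb Cf Hf.
destruct (approxC_weight a (/ (2 * lam ^ 2)) C (fun x => b x / (4 * lam ^ 2 - x ^ 2)) f) as [H1 H2]; auto.
- replace (fun x => b x / (4 * lam ^ 2 - x ^ 2)) with (fun x => (fun _ => 1) x * (b x / (4 * lam ^ 2 - x ^ 2)))
    by (apply functional_extensionality; intros x; ring).
  apply weight_continuity; auto. apply continuity_const; now intros ??.
- intros x; now apply weight_bound.
- repeat split; try apply H1; [exact H2|].
  intros x Hx. destruct Hb as [_ [_ [_ Hb]]]. unfold Wb; rewrite Hb by exact Hx.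
  unfold Cscal, Rdiv; f_equal; ring.
Qed.

(** Where [b] is nonzero the extra factor satisfies [|x| <= 3 / 2 * lam], as [sqrt 2 <= 3 / 2], and
    it multiplies the bound [/ (2 * lam ^ 2)] of [weight_bound]. *)
Lemma Wtb_props a C lam b f : 0 <= a -> 0 < lam -> cutoff lam b -> approximableC f -> bnd a C f ->
  approximableC (Wtb lam b f) /\ bnd a (3 / (4 * lam) * C) (Wtb lam b f) /\ csupp (sqrt 2 * lam) (Wtb lam b f).
Proof.
intros Ha Hl Hb Cf Hf.
set (c := fun x => x * (b x / (4 * lam ^ 2 - x ^ 2))).
assert (Hcc : continuity c).
{ apply (weight_continuity lam b (fun x => x)); auto. exact (derivable_continuous _ derivable_id). }
assert (HcK : forall x, Rabs (c x) <= 3 / (4 * lam)).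
{ intros x; unfold c; rewrite Rabs_mult. assert (Hw := weight_bound lam b x Hl Hb).
  destruct (Req_dec (b x) 0) as [Hx|Hx].
  - rewrite Hx; unfold Rdiv; rewrite Rmult_0_l, Rabs_R0, Rmult_0_r.
    apply Rmult_le_pos; [lra|]. left; apply Rinv_0_lt_compat; lra.
  - destruct (cutoff_nonzero lam b x Hl Hb Hx) as [Hx1 _].
    replace (3 / (4 * lam)) with (3 / 2 * lam * / (2 * lam ^ 2)) by (field; lra).
    apply Rmult_le_compat; auto using Rabs_pos. }
destruct (approxC_weight a _ C c f Ha Hcc HcK Cf Hf) as [[H1 H2] H3].
assert (E : forall x, Wtb lam b f x = Cmul Ci (Cscal (c x) (f x))).
{ intros x; unfold Wtb, Cmul, Cscal, Ci, c, Rdiv; simpl; f_equal; ring. }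
repeat split.
- apply approx_ext with (fun x => (-1) * Im (Cscal (c x) (f x)) + 0 * Im (Cscal (c x) (f x))).
  + intros x; rewrite E; simpl; ring.
  + now apply approx_lin.
- apply approx_ext with (fun x => 1 * Re (Cscal (c x) (f x)) + 0 * Re (Cscal (c x) (f x))).
  + intros x; rewrite E; simpl; ring.
  + now apply approx_lin.
- intros x; rewrite E, Cnorm_mul. replace (Cnorm Ci) with 1; [rewrite Rmult_1_l; apply H3|].
  unfold Cnorm; simpl. replace (0 * (0 * 1) + 1 * (1 * 1)) with 1 by ring. now rewrite sqrt_1.
- intros x Hx. destruct Hb as [_ [_ [_ Hb]]]. rewrite E; unfold c; rewrite Hb by exact Hx.
  unfold Cmul, Cscal, Rdiv; simpl; f_equal; ring.
Qed.

Lemma Wb_sub lam b f g x : Wb lam b (fun x => Csub (f x) (g x)) x = Csub (Wb lam b f x) (Wb lam b g x).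
Proof. apply Cscal_sub. Qed.

Lemma Wtb_sub lam b f g x : Wtb lam b (fun x => Csub (f x) (g x)) x = Csub (Wtb lam b f x) (Wtb lam b g x).
Proof. unfold Wtb, Cmul, Csub; simpl; f_equal; ring. Qed.

Lemma bnd_ext a C f g : (forall x, f x = g x) -> bnd a C f -> bnd a C g.
Proof. intros H Hf x; rewrite <- H; apply Hf. Qed.

(** [q] is the cost of one more convolution with [Wb f] when [f] lies in the ball of radius [2 * G].
    It equals [2 / 3 * sqrt 2 * (G / lam)], and [2 / 3 * (3 / 2) * (1 / 6)] is where the factor 6 in
    the hypothesis is spent. *)
Lemma scaled_q_bounds lam G : 0 < lam -> 0 <= G -> 6 * G <= lam ->
  let q := 2 / 3 * (sqrt 2 * lam) * (/ (2 * lam ^ 2) * (2 * G)) in 0 <= q <= 1 / 6.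
Proof.
intros Hl HG H6 q. pose proof sqrt2_bounds.
assert (Hq : q = 2 / 3 * sqrt 2 * (G / lam)) by (unfold q; field; lra).
assert (0 <= G / lam <= 1 / 6).
{ split; [apply Rmult_le_pos; [lra|left; now apply Rinv_0_lt_compat]|].
  apply Rmult_le_reg_r with lam; [lra|]. unfold Rdiv at 1; rewrite Rmult_assoc, Rinv_l; lra. }
rewrite Hq; nra.
Qed.

(** The quadratic term is at most [9 / 16 * q * G] and the exponential one [24 / 5 * q * G]; with
    [q <= 1 / 6] their sum stays below [G], which leaves room for [v] in the ball of radius
    [2 * G]. *)
Lemma Rop_props a lam G b v f : 0 <= a -> 0 < lam -> 0 <= G -> 6 * G <= lam -> cutoff lam b ->
  approximableC v -> bnd a G v -> approximableC f -> bnd a (2 * G) f ->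
  approximableC (Rop lam b v f) /\ bnd a (2 * G) (Rop lam b v f).
Proof.
intros Ha Hl HG H6 Hb Cv Hv Cf Hf.
destruct (Wb_props a _ lam b f Ha Hl Hb Cf Hf) as [W1 [W2 W3]].
destruct (Wtb_props a _ lam b f Ha Hl Hb Cf Hf) as [T1 [T2 T3]].
assert (HS : 0 < sqrt 2 * lam) by (pose proof sqrt2_bounds; nra).
assert (Hq := scaled_q_bounds lam G Hl HG H6); cbv zeta in Hq.
set (q := 2 / 3 * (sqrt 2 * lam) * (/ (2 * lam ^ 2) * (2 * G))) in *.
destruct (exp2star_props a _ _ _ Ha HS W1 W2 W3 (proj2 Hq)) as [E1 E2].
assert (C1 := approxC_conv a _ _ _ _ _ Ha HS T1 T1 T2 T2 T3).
assert (C2 := bnd_conv a _ _ _ _ _ Ha HS T1 T1 T2 T2 T3).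
split.
- apply (approxC_add (fun x => Csub (Cscal (1 / 4) (conv (Wtb lam b f) (Wtb lam b f) x))
             (Cscal (4 * lam ^ 2) (exp2star (Wb lam b f) x))) v); [|exact Cv].
  apply approxC_sub; now apply approxC_scal.
- eapply bnd_weaken; [|eapply (bnd_add a _ _ (fun x => Csub (Cscal (1 / 4) (conv (Wtb lam b f) (Wtb lam b f) x))
             (Cscal (4 * lam ^ 2) (exp2star (Wb lam b f) x))) v); [|exact Hv]].
  2:{ eapply bnd_sub; eapply bnd_scal; [exact C2|exact E2]. }
  fold q. rewrite !Rabs_right by (try nra; pose proof (pow2_ge_0 lam); lra).
  replace (1 / 4 * (2 / 3 * (sqrt 2 * lam) * (3 / (4 * lam) * (2 * G)) * (3 / (4 * lam) * (2 * G))))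
    with (9 / 16 * G * q) by (unfold q; field; lra).
  replace (4 * lam ^ 2 * (6 / 5 * (/ (2 * lam ^ 2) * (2 * G) * q))) with (24 / 5 * G * q) by (field; lra).
  nra.
Qed.

(** [v] cancels, and the two remaining terms reproduce the coefficients [9 / 16] and [24 / 5], now
    multiplying [D]; [(9 / 16 + 24 / 5) / 6] is just below [9 / 10]. *)
Lemma Rop_diff a lam G D b v f g : 0 <= a -> 0 < lam -> 0 <= G -> 6 * G <= lam -> cutoff lam b ->
  approximableC f -> bnd a (2 * G) f -> approximableC g -> bnd a (2 * G) g ->
  bnd a D (fun x => Csub (f x) (g x)) ->
  bnd a (9 / 10 * D) (fun x => Csub (Rop lam b v f x) (Rop lam b v g x)).
Proof.
intros Ha Hl HG H6 Hb Cf Hf Cg Hg HD.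
destruct (Wb_props a _ lam b f Ha Hl Hb Cf Hf) as [W1 [W2 W3]].
destruct (Wtb_props a _ lam b f Ha Hl Hb Cf Hf) as [T1 [T2 T3]].
destruct (Wb_props a _ lam b g Ha Hl Hb Cg Hg) as [W1' [W2' W3']].
destruct (Wtb_props a _ lam b g Ha Hl Hb Cg Hg) as [T1' [T2' T3']].
destruct (Wb_props a _ lam b _ Ha Hl Hb (approxC_sub f g Cf Cg) HD) as [_ [WD _]].
destruct (Wtb_props a _ lam b _ Ha Hl Hb (approxC_sub f g Cf Cg) HD) as [_ [TD _]].
apply (bnd_ext a _ _ _ (Wb_sub lam b f g)) in WD. apply (bnd_ext a _ _ _ (Wtb_sub lam b f g)) in TD.
assert (HD0 := bnd_ge_0 _ _ _ HD).
assert (HS : 0 < sqrt 2 * lam) by (pose proof sqrt2_bounds; nra).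
assert (Hq := scaled_q_bounds lam G Hl HG H6); cbv zeta in Hq.
set (q := 2 / 3 * (sqrt 2 * lam) * (/ (2 * lam ^ 2) * (2 * G))) in *.
assert (E := exp2star_diff a _ _ _ _ _ Ha HS W1 W1' W2 W2' W3 W3' (proj2 Hq) WD).
assert (C := bnd_conv_diff a _ _ _ _ _ _ _ _ _ Ha HS T1 T1' T1 T1' T2 T2' T2 T2' T3 T3' TD TD).
apply bnd_ext with (fun x => Csub
   (Cscal (1 / 4) (Csub (conv (Wtb lam b f) (Wtb lam b f) x) (conv (Wtb lam b g) (Wtb lam b g) x)))
   (Cscal (4 * lam ^ 2) (Csub (exp2star (Wb lam b f) x) (exp2star (Wb lam b g) x)))).
{ intros x; unfold Rop, Cadd, Csub, Cscal; simpl; f_equal; ring. }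
eapply bnd_weaken; [|eapply bnd_sub; eapply bnd_scal; [exact C|exact E]].
fold q. rewrite !Rabs_right by (try nra; pose proof (pow2_ge_0 lam); lra).
replace (1 / 4 * (2 / 3 * (sqrt 2 * lam) * (3 / (4 * lam) * D * (3 / (4 * lam) * (2 * G)) + 3 / (4 * lam) * (2 * G) * (3 / (4 * lam) * D))))
  with (9 / 16 * D * q) by (unfold q; field; lra).
replace (4 * lam ^ 2 * (12 / 5 * q * (/ (2 * lam ^ 2) * D))) with (24 / 5 * D * q) by (field; lra).
nra.
Qed.

(** * From weighted bounds to L1 norms *)

(** From [exp (u / 2) >= 1 + u / 2] one gets [exp u >= (1 + u ^ 2) / 4]. The Lorentzian has the
    smooth bounded primitive [4 / a * atan (a * x)], which avoids the kink of the weight at 0 and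
    yields the total [4 * PI / a]. *)
Lemma wt_le_lorentz a x : 0 < a -> wt a x <= 4 / (1 + (a * x) ^ 2).
Proof.
intros Ha; unfold wt. set (u := a * Rabs x).
assert (Hu : 0 <= u) by (apply Rmult_le_pos; [lra|apply Rabs_pos]).
replace ((a * x) ^ 2) with (u ^ 2) by (unfold u; rewrite !Rpow_mult_distr, pow2_abs; reflexivity).
replace (- a * Rabs x) with (- u) by (unfold u; ring). rewrite exp_Ropp.
assert (H := exp_ineq1_le (u / 2)).
assert (He : exp u = exp (u / 2) * exp (u / 2)) by (rewrite <- exp_plus; f_equal; field).
assert (Hu2 : 0 < 1 + u ^ 2) by nra.
replace (4 / (1 + u ^ 2)) with (/ ((1 + u ^ 2) / 4)) by (field; lra).
apply Rinv_le_contravar; [nra|]. rewrite He. nra.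
Qed.

Lemma norm_int_bound a C f A B : 0 < a -> A <= B -> approximableC f -> bnd a C f ->
  0 <= HK_int A B (fun x => Cnorm (f x)) <= C * (4 * PI / a).
Proof.
intros Ha HAB Cf Hf. assert (HC := bnd_ge_0 _ _ _ Hf). assert (Cn := approxC_norm f Cf).
assert (HI := approx_int _ A B Cn HAB). split.
- apply le_epsilon; intros eps Heps.
  destruct (HI eps Heps) as [d [Hd H]]. destruct (cousin d A B Hd HAB) as [l [Hl Hfi]].
  specialize (H l Hl Hfi). apply Rabs_def2 in H.
  assert (0 <= rsum (fun x => Cnorm (f x)) l); [|lra].
  clear - Hl. revert A Hl; induction l as [|[[x t] y] l IH]; simpl; intros A; [lra|].
  intros [-> [Ht Hl]]. specialize (IH y Hl).
  assert (0 <= Cnorm (f t) * (y - A)) by (apply Rmult_le_pos; [apply Cnorm_ge_0|lra]). lra.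
- apply le_epsilon; intros eps Heps.
  assert (He : 0 < eps / (C * (B - A) + 1)) by (apply Rdiv_lt_0_compat; nra).
  set (e := eps / (C * (B - A) + 1)) in *.
  assert (Hder : forall x, derivable_pt_lim (fun x => 4 / a * atan (a * x)) x (4 / (1 + (a * x) ^ 2))).
  { intros x; apply is_derive_Reals. auto_derive; [auto|].
    assert (0 < 1 + (a * x) ^ 2) by (pose proof (pow2_ge_0 (a * x)); lra).
    field; split; simpl in *; lra. }
  destruct (straddle _ _ Hder e He) as [d [Hd H]].
  apply Rle_trans with (C * (4 / a * atan (a * B) - 4 / a * atan (a * A) + e * (B - A))).
  + assert (Hs : small A B (wt a) (4 / a * atan (a * B) - 4 / a * atan (a * A) + e * (B - A))).
    { assert (Hmain : forall x t y, x <= t -> t <= y -> t - d t < x -> y < t + d t ->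
        wt a t * (y - x) <= (4 / a * atan (a * y) + e * y) - (4 / a * atan (a * x) + e * x)).
      { intros x t y Hx Hy Hdx Hdy. specialize (H x t y Hx Hy Hdx Hdy).
        apply Rabs_le_between in H.
        pose proof (wt_le_lorentz a t Ha).
        assert (wt a t * (y - x) <= 4 / (1 + (a * t) ^ 2) * (y - x)) by (apply Rmult_le_compat_r; lra). lra. }
      (* The straddle error [e * (y - x)] is itself an increment, so adding [e * x] absorbs it into
         the majorant. *)
      exists d, (fun x => 4 / a * atan (a * x) + e * x); repeat split.
      - exact Hd.
      - intros x y _ Hxy _.
        assert (Hat : atan (a * x) <= atan (a * y)).
        { destruct (Req_dec x y) as [->|Hn]; [lra|]. left; apply atan_increasing. nra. }
        assert (0 < 4 / a) by (apply Rdiv_lt_0_compat; lra). nra.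
      - lra.
      - intros x t y _ Hx Hy _ Hdx Hdy. rewrite Rabs_right by (left; apply wt_pos).
        now apply Hmain. }
    apply Rle_trans with (1 := Rle_abs _).
    apply small_int with (A := A) (B := B) (phi := fun x => Cnorm (f x)); auto.
    apply small_dom with (wt a); auto. intros x _.
    rewrite !Rabs_right by (apply Rle_ge; auto using Cnorm_ge_0, Rlt_le, wt_pos). apply Hf.
  + assert (HB := atan_bound (a * B)). assert (HA := atan_bound (a * A)).
    assert (Hat : 4 / a * atan (a * B) - 4 / a * atan (a * A) <= 4 * PI / a).
    { replace (4 * PI / a) with (4 / a * PI) by (field; lra).
      assert (0 < 4 / a) by (apply Rdiv_lt_0_compat; lra). nra. }
    assert (eps = (C * (B - A) + 1) * e) by (unfold e; field; nra).
    assert (C * (4 / a * atan (a * B) - 4 / a * atan (a * A)) <= C * (4 * PI / a)) by (now apply Rmult_le_compat_l).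
    nra.
Qed.

Lemma approxC_L1 a C f : 0 < a -> approximableC f -> bnd a C f -> L1 f.
Proof.
intros Ha Cf Hf; split.
- intros A B HAB. repeat split; apply approx_integrable; auto; try apply Cf. now apply approxC_norm.
- exists (C * (4 * PI / a)); intros A B HAB. now apply (norm_int_bound a C f A B).
Qed.

(** The integrals of the norm over [[- n, n]] grow and are bounded, so the limit picked by [Rint]
    exists and inherits the bound. *)
Lemma L1norm_bound a C f : 0 < a -> approximableC f -> bnd a C f -> 0 <= L1norm f <= C * (4 * PI / a).
Proof.
intros Ha Cf Hf. assert (Cn := approxC_norm f Cf).
set (u := fun n => HK_int (- INR n) (INR n) (fun x => Cnorm (f x))).
assert (Hu : forall n, 0 <= u n <= C * (4 * PI / a)).
{ intros n; apply (norm_int_bound a C f); auto. pose proof (pos_INR n); lra. }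
assert (Hg : Un_growing u).
{ intros n. unfold u. pose proof (pos_INR n). assert (INR n <= INR (S n)) by (rewrite S_INR; lra).
  rewrite (approx_chasles _ (- INR (S n)) (- INR n) (INR (S n)) Cn ltac:(lra) ltac:(lra)).
  rewrite (approx_chasles _ (- INR n) (INR n) (INR (S n)) Cn ltac:(lra) ltac:(lra)).
  pose proof (norm_int_bound a C f (- INR (S n)) (- INR n) Ha ltac:(lra) Cf Hf).
  pose proof (norm_int_bound a C f (INR n) (INR (S n)) Ha ltac:(lra) Cf Hf). lra. }
destruct (growing_cv u Hg) as [I HI].
{ exists (C * (4 * PI / a)); intros x [n ->]; apply Hu. }
unfold L1norm; rewrite (rint_eq _ I HI). split.
- apply Rle_trans with (u O); [apply Hu|]. now apply growing_ineq.
- apply Rnot_lt_le; intros Hlt. destruct (HI (I - C * (4 * PI / a)) ltac:(lra)) as [N HN].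
  specialize (HN N ltac:(lia)). specialize (Hu N). unfold Rdist in HN. apply Rabs_def2 in HN. lra.
Qed.

(** * Limit of the iterates *)

Lemma le_of_geometric r K x y : 0 <= K -> 0 <= r < 1 -> (forall n, x <= y + K * r ^ n) -> x <= y.
Proof.
intros HK Hr H; apply le_epsilon; intros eps Heps.
destruct (pow_lt_1_zero r) with (y := eps / (K + 1)) as [N HN].
{ rewrite Rabs_right; lra. } { apply Rdiv_lt_0_compat; lra. }
specialize (HN N ltac:(lia)). assert (0 <= r ^ N) by (apply pow_le; lra). rewrite Rabs_right in HN by lra.
assert (eps = (K + 1) * (eps / (K + 1))) by (field; lra). specialize (H N). nra.
Qed.

(** Summing the steps gives [1 / (1 - 9 / 10) = 10]; taking limits of real and imaginary parts
    separately doubles it to 20. *)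
Lemma geometric_steps_limit (u : nat -> R -> Cplx) a D : 0 <= a -> 0 <= D ->
  (forall n, bnd a (D * (9 / 10) ^ n) (fun x => Csub (u (S n) x) (u n x))) ->
  exists psi, forall n, bnd a (20 * D * (9 / 10) ^ n) (fun x => Csub (u n x) (psi x)).
Proof.
intros Ha HD Hu.
(* Keeping the term [- (9 / 10) ^ m] makes the bound telescope, so the induction on [m] loses
   nothing. *)
assert (Hnm : forall x n m, (n <= m)%nat ->
   Cnorm (Csub (u m x) (u n x)) <= 10 * D * wt a x * ((9 / 10) ^ n - (9 / 10) ^ m)).
{ intros x n m Hnm; induction Hnm as [|m Hnm IH].
  - replace (Csub (u n x) (u n x)) with ((0, 0) : Cplx) by (unfold Csub; f_equal; ring).
    rewrite Cnorm_0; lra.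
  - replace (Csub (u (S m) x) (u n x)) with (Cadd (Csub (u (S m) x) (u m x)) (Csub (u m x) (u n x)))
      by (unfold Cadd, Csub; simpl; f_equal; ring).
    eapply Rle_trans; [apply Cnorm_add|]. specialize (Hu m x).
    rewrite <- (tech_pow_Rmult _ m). simpl in Hu. lra. }
assert (Hp : forall x m, 0 <= D * wt a x * (9 / 10) ^ m).
{ intros x m; apply Rmult_le_pos; [apply Rmult_le_pos; [lra|left; apply wt_pos]|apply pow_le; lra]. }
assert (Hlim : forall (p : Cplx -> R), (forall z, Rabs (p z) <= Cnorm z) ->
   (forall z w, p (Csub z w) = p z - p w) ->
   forall x, exists s, forall n, Rabs (p (u n x) - s) <= 10 * D * wt a x * (9 / 10) ^ n).
{ intros p Hpn Hps x.
  assert (Hc : forall n m, (n <= m)%nat -> Rabs (p (u m x) - p (u n x)) <= 10 * D * wt a x * (9 / 10) ^ n).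
  { intros n m Hm. rewrite <- Hps. eapply Rle_trans; [apply Hpn|]. eapply Rle_trans; [now apply Hnm|].
    specialize (Hp x m). lra. }
  assert (Hk : 0 <= 10 * D * wt a x) by (specialize (Hp x O); simpl in Hp; lra).
  assert (Hcau : Cauchy_crit (fun n => p (u n x))).
  { intros eps Heps. destruct (pow_lt_1_zero (9 / 10)) with (y := eps / (10 * D * wt a x + 1)) as [N HN].
    { rewrite Rabs_right; lra. } { apply Rdiv_lt_0_compat; lra. }
    assert (HN' : forall n, (N <= n)%nat -> 10 * D * wt a x * (9 / 10) ^ n < eps).
    { intros n Hn. specialize (HN n Hn). assert (0 <= (9 / 10) ^ n) by (apply pow_le; lra).
      rewrite Rabs_right in HN by lra.
      assert (eps = (10 * D * wt a x + 1) * (eps / (10 * D * wt a x + 1))) by (field; lra). nra. }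
    exists N; intros n m Hn Hm. unfold Rdist. destruct (Nat.le_ge_cases n m) as [H|H].
    - rewrite Rabs_minus_sym. eapply Rle_lt_trans; [now apply Hc|]. now apply HN'.
    - eapply Rle_lt_trans; [now apply Hc|]. now apply HN'. }
  destruct (R_complete _ Hcau) as [s Hs]. exists s; intros n.
  apply le_epsilon; intros eps Heps. destruct (Hs eps Heps) as [M HM].
  specialize (HM (max M n) ltac:(lia)). specialize (Hc n (max M n) ltac:(lia)).
  unfold Rdist in HM. rewrite Rabs_minus_sym in Hc.
  replace (p (u n x) - s) with ((p (u n x) - p (u (max M n) x)) + (p (u (max M n) x) - s)) by ring.
  eapply Rle_trans; [apply Rabs_triang|]. lra. }
set (HR := Hlim Re Re_le_Cnorm ltac:(reflexivity)). set (HI := Hlim Im Im_le_Cnorm ltac:(reflexivity)).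
exists (fun x => (proj1_sig (constructive_indefinite_description _ (HR x)),
                  proj1_sig (constructive_indefinite_description _ (HI x)))).
intros n x. destruct constructive_indefinite_description as [s Hs].
destruct constructive_indefinite_description as [s' Hs']; simpl.
eapply Rle_trans; [apply Cnorm_le_sum|].
apply Rle_trans with (10 * D * wt a x * (9 / 10) ^ n + 10 * D * wt a x * (9 / 10) ^ n); [|lra].
exact (Rplus_le_compat _ _ _ _ (Hs n) (Hs' n)).
Qed.

Lemma approxC_limit a K (u : nat -> R -> Cplx) psi : 0 <= a -> 0 <= K ->
  (forall n, approximableC (u n)) -> (forall n, bnd a (K * (9 / 10) ^ n) (fun x => Csub (u n x) (psi x))) ->
  approximableC psi.
Proof.
intros Ha HK Cu Hu.
assert (Hp : forall (p : Cplx -> R), (forall z, Rabs (p z) <= Cnorm z) ->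
   (forall z w, p (Csub z w) = p z - p w) -> (forall n, approximable (fun x => p (u n x))) ->
   approximable (fun x => p (psi x))).
{ intros p Hpn Hps Hc. apply approx_uniform_limit; intros A B eps HAB Heps.
  destruct (pow_lt_1_zero (9 / 10)) with (y := eps / (K + 1)) as [N HN].
  { rewrite Rabs_right; lra. } { apply Rdiv_lt_0_compat; lra. }
  exists (fun x => p (u N x)); split; [apply Hc|]. intros x _.
  rewrite Rabs_minus_sym, <- Hps. eapply Rle_trans; [apply Hpn|].
  eapply Rle_trans; [exact (bnd_Cnorm a _ _ x Ha (Hu N))|].
  specialize (HN N ltac:(lia)). assert (0 <= (9 / 10) ^ N) by (apply pow_le; lra).
  rewrite Rabs_right in HN by lra.
  assert (eps = (K + 1) * (eps / (K + 1))) by (field; lra). nra. }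
split; apply Hp; auto using Re_le_Cnorm, Im_le_Cnorm; intros n; apply Cu.
Qed.

(** The entry point from gauge integrability: [v] passes through here once, and all later functions
    are built from it by operations preserving [approximableC]. *)
Lemma L1_bounded_approximableC C f : L1 f -> (forall x, Cnorm (f x) <= C) -> approximableC f.
Proof.
intros [Hf _] HC; split; apply bounded_hk_approximable with C.
- intros x; eapply Rle_trans; [apply Re_le_Cnorm|apply HC].
- intros x y Hxy; apply (Hf x y Hxy).
- intros x; eapply Rle_trans; [apply Im_le_Cnorm|apply HC].
- intros x y Hxy; apply (Hf x y Hxy).
Qed.

Theorem theorem7p5 (lam a Gamma : R) (b : R -> R) (v : R -> Cplx) :
  0 < lam -> 0 < a -> 0 <= Gamma ->
  6 * Rmax Gamma (/ a) <= lam ->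
  cutoff lam b ->
  L1 v ->
  (forall xi, Cnorm (v xi) <= Gamma * exp (- a * Rabs xi)) ->
  exists psi : R -> Cplx,
    L1 psi /\ L1 (Rop lam b v psi) /\
    L1norm (fun xi => Csub (psi xi) (Rop lam b v psi xi)) = 0 /\
    (forall n, L1 (iterR lam b v n)) /\
    Un_cv (fun n => L1norm (fun xi => Csub (iterR lam b v n xi) (psi xi))) 0 /\
    (forall xi, Cnorm (psi xi) <= 2 * Gamma * exp (- (a - / lam) * Rabs xi)).
Proof.
intros Hl Ha HG Hmax Hb HLv Hv.
assert (H6 : 6 * Gamma <= lam) by (pose proof (Rmax_l Gamma (/ a)); lra).
assert (Ha' : 0 <= a) by lra.
assert (Cv : approximableC v) by (apply (L1_bounded_approximableC Gamma); auto; intros x; exact (bnd_Cnorm a Gamma v x Ha' Hv)).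
assert (Hit : forall n, approximableC (iterR lam b v n) /\ bnd a (2 * Gamma) (iterR lam b v n)).
{ induction n as [|n [IH1 IH2]]; simpl iterR.
  - split; [exact Cv|]. apply bnd_weaken with Gamma; [lra|exact Hv].
  - now apply Rop_props. }
(* The initial [4 * Gamma] is the diameter bound of the invariant ball; [Rop_diff] supplies the
   ratio. *)
assert (Hstep : forall n, bnd a (4 * Gamma * (9 / 10) ^ n) (fun x => Csub (iterR lam b v (S n) x) (iterR lam b v n x))).
{ induction n as [|n IH].
  - apply bnd_weaken with (2 * Gamma + 2 * Gamma); [simpl; lra|]. apply bnd_sub; apply Hit.
  - rewrite <- tech_pow_Rmult.
    replace (4 * Gamma * (9 / 10 * (9 / 10) ^ n)) with (9 / 10 * (4 * Gamma * (9 / 10) ^ n)) by ring.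
    apply (Rop_diff a lam Gamma _ b v (iterR lam b v (S n)) (iterR lam b v n)); auto; apply Hit. }
destruct (geometric_steps_limit _ a (4 * Gamma) Ha' ltac:(lra) Hstep) as [psi Hpsi].
assert (Cpsi : approximableC psi).
{ apply (approxC_limit a (20 * (4 * Gamma)) (iterR lam b v)); auto; [lra|apply Hit]. }
assert (Hw : forall x, 0 <= 20 * (4 * Gamma) * wt a x) by (intros x; pose proof (wt_pos a x); nra).
assert (Bpsi : bnd a (2 * Gamma) psi).
{ intros x. apply le_of_geometric with (9 / 10) (20 * (4 * Gamma) * wt a x); [apply Hw|lra|]. intros n.
  replace (psi x) with (Csub (iterR lam b v n x) (Csub (iterR lam b v n x) (psi x)))
    by (destruct (psi x); unfold Csub; simpl; f_equal; ring).
  eapply Rle_trans; [apply Cnorm_sub|]. destruct (Hit n) as [_ H1]. specialize (H1 x).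
  specialize (Hpsi n x); simpl in Hpsi. lra. }
destruct (Rop_props a lam Gamma b v psi Ha' Hl HG H6 Hb Cv Hv Cpsi Bpsi) as [CR BR].
(* With constant 0 this is equality at every point. It follows by letting [n] grow in the splitting
   of the defect into R psi_n - R psi, small by contraction, and psi_(n+1) - psi, small by
   convergence. *)
assert (Hfix : bnd a 0 (fun x => Csub (psi x) (Rop lam b v psi x))).
{ intros x. apply le_of_geometric with (9 / 10) (2 * (20 * (4 * Gamma) * wt a x)); [specialize (Hw x); lra|lra|].
  intros n. destruct (Hit n) as [H1 H2].
  assert (HD := Rop_diff a lam Gamma _ b v _ _ Ha' Hl HG H6 Hb H1 H2 Cpsi Bpsi (Hpsi n) x).
  assert (HS := Hpsi (S n) x). cbv beta in HD, HS. rewrite <- tech_pow_Rmult in HS. simpl iterR in HS.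
  replace (Csub (psi x) (Rop lam b v psi x)) with
    (Csub (Csub (Rop lam b v (iterR lam b v n) x) (Rop lam b v psi x)) (Csub (Rop lam b v (iterR lam b v n) x) (psi x)))
    by (unfold Csub; simpl; f_equal; ring).
  eapply Rle_trans; [apply Cnorm_sub|].
  assert (0 <= 20 * (4 * Gamma) * wt a x * (9 / 10) ^ n) by (apply Rmult_le_pos; [apply Hw|apply pow_le; lra]).
  lra. }
exists psi; split; [|split; [|split; [|split; [|split]]]].
- apply (approxC_L1 a (2 * Gamma)); auto.
- apply (approxC_L1 a (2 * Gamma)); auto.
- assert (Hz := L1norm_bound a 0 _ Ha (approxC_sub _ _ Cpsi CR) Hfix). lra.
- intros n; apply (approxC_L1 a (2 * Gamma)); auto; apply Hit.
- intros eps Heps. set (K := 20 * (4 * Gamma) * (4 * PI / a)).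
  assert (HK : 0 <= K).
  { pose proof PI_RGT_0. apply Rmult_le_pos; [lra|]. left; apply Rdiv_lt_0_compat; lra. }
  destruct (pow_lt_1_zero (9 / 10)) with (y := eps / (K + 1)) as [N HN].
  { rewrite Rabs_right; lra. } { apply Rdiv_lt_0_compat; lra. }
  exists N; intros n Hn. specialize (HN n Hn). assert (0 <= (9 / 10) ^ n) by (apply pow_le; lra).
  rewrite Rabs_right in HN by lra.
  assert (HB := L1norm_bound a _ _ Ha (approxC_sub _ _ (proj1 (Hit n)) Cpsi) (Hpsi n)).
  replace (20 * (4 * Gamma) * (9 / 10) ^ n * (4 * PI / a)) with (K * (9 / 10) ^ n) in HB by (unfold K; ring).
  unfold Rdist; rewrite Rminus_0_r, Rabs_right by lra.
  assert (eps = (K + 1) * (eps / (K + 1))) by (field; lra). nra.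
- intros x; eapply Rle_trans; [apply Bpsi|]. apply Rmult_le_compat_l; [lra|].
  unfold wt; apply exp_le_mono. assert (0 < / lam) by now apply Rinv_0_lt_compat.
  pose proof (Rabs_pos x). nra.
Qed.
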